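(* Let $\Lambda$ be a noether algebra with center $\Lambda^{c}$, and let $d\ge 0$ be an integer such that the finitistic global dimension of $\Lambda$ is at most $d$. Suppose there exist a finitely generated $\Lambda$-module $G$ and a non-negative integer $s$ such that $\Omega^{s}_{\Lambda}(\mathrm{mod}\,\Lambda)\subseteq |\Omega^{*}_{\Lambda}G|_{n}$ for some integer $n\ge 0$. Then for $I=\mathrm{ann}_{\Lambda^{c}}\mathrm{Ext}^{d+1}_{\Lambda}(G,\Omega^{d+1}_{\Lambda}G)$ there are equalities \[ \mathrm{Sing}\,\Lambda=\mathcal{V}(\mathsf{ca}(\Lambda))=\mathcal{V}(\mathsf{ca}^{s+d+1}(\Lambda))=\mathcal{V}(I). \] In particular, $\mathrm{Sing}\,\Lambda$ is a closed subset of $\mathrm{Spec}\,\Lambda^{c}$.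
   Context: A noether algebra is a noetherian ring $\Lambda$ that is finitely generated as a module over its center $\Lambda^{c}$. Modules are right modules; $\mathrm{mod}\,\Lambda$ is the category of finitely generated $\Lambda$-modules. For $n\ge 0$, $\mathsf{ca}^{n}(\Lambda)$ is the ideal of all $a\in\Lambda^{c}$ with $a\,\mathrm{Ext}^{i}_{\Lambda}(M,N)=0$ for all $M,N\in\mathrm{mod}\,\Lambda$ and all $i\ge n$; and $\mathsf{ca}(\Lambda)=\bigcup_{n\ge 0}\mathsf{ca}^{n}(\Lambda)$. For an ideal $J$ of $\Lambda^{c}$, $\mathcal{V}(J)=\{\mathfrak p\in\mathrm{Spec}\,\Lambda^{c}\mid \mathfrak p\supseteq J\}$. $\mathrm{Reg}\,\Lambda=\{\mathfrak p\in\mathrm{Spec}\,\Lambda^{c}\mid \mathrm{gldim}\,\Lambda_{\mathfrak p}<\infty\}$ and $\mathrm{Sing}\,\Lambda=\mathrm{Spec}\,\Lambda^{c}\setminus\mathrm{Reg}\,\Lambda$, where $\mathrm{gldim}$ is global dimension. The finitistic global dimension of $\Lambda$ is $\sup\{\mathrm{gldim}\,\Lambda_{\mathfrak p}\mid \mathfrak p\in\mathrm{Reg}\,\Lambda\}$. Syzygies: $\Omega_{\Lambda}M$ is the kernel of a surjection $P\to M$ with $P$ projective (finitely generated when $M$ is); $\Omega^{0}M=M$ and $\Omega^{n}M=\Omega(\Omega^{n-1}M)$. Syzygies are defined up to projective summands. $\Omega^{s}_{\Lambda}(\mathrm{mod}\,\Lambda)=\{\Omega^{s}_{\Lambda}M\mid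 M\in\mathrm{mod}\,\Lambda\}$. $\Omega^{*}_{\Lambda}G=\bigcup_{i\ge 0}\{\Omega^{i}_{\Lambda}G\}$, with the convention that it contains all finitely generated projective $\Lambda$-modules. For a subcategory $\mathcal X\subseteq\mathrm{mod}\,\Lambda$, $\mathrm{add}\,\mathcal X$ consists of direct summands of finite direct sums of modules in $\mathcal X$; $|\mathcal X|_{0}=\{0\}$, $|\mathcal X|_{1}=\mathrm{add}\,\mathcal X$, and for $n\ge 2$, $|\mathcal X|_{n}$ consists of the $M\in\mathrm{mod}\,\Lambda$ that fit into an exact sequence $0\to Y\to M\oplus W\to X\to 0$ with $Y\in|\mathcal X|_{n-1}$ and $X\in\mathrm{add}\,\mathcal X$ (for some $W\in\mathrm{mod}\,\Lambda$). *)

(* Defs.v *)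
From HB Require Import structures.
From mathcomp Require Import all_boot all_order all_algebra generic_quotient.
From mathcomp Require Import boolp classical_sets ring.

Set Implicit Arguments.
Unset Strict Implicit.
Unset Printing Implicit Defensive.

Import GRing.Theory.
Local Open Scope ring_scope.
Local Open Scope quotient_scope.
Local Open Scope classical_set_scope.

(* Rings are [pzRingType]s (the zero ring is allowed). All module theory is   *)
(* developed for [lmodType A]; right modules over R are [lmodType R^c], where *)
(* R^c is the opposite ring, so that  x . r  is written  r *: x.              *)

Section Spectrum.
Variable K : comPzRingType.

Definition is_ideal (J : set K) : Prop :=
  [/\ J 0, forall x y, J x -> J y -> J (x + y)
    & forall c x, J x -> J (c * x)].

Definition is_prime_ideal (p : set K) : Prop :=
  [/\ is_ideal p, ~ p 1 & forall x y, p (x * y) -> p x \/ p y].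

Record Spec := MkSpec { spec_set : set K; _ : is_prime_ideal spec_set }.

Lemma specP (p : Spec) : is_prime_ideal (spec_set p). Proof. by case: p. Qed.

Definition V (J : set K) : set Spec := [set p | J `<=` spec_set p].

Definition zariski_closed (Z : set Spec) : Prop :=
  exists2 J : set K, is_ideal J & Z = V J.

End Spectrum.

Section Center.
Variable R : pzRingType.

Definition center_pred : pred R := fun x => `[< forall y : R, x * y = y * x >].

Lemma center_predP x : reflect (forall y : R, x * y = y * x) (x \in center_pred).
Proof. exact: asboolP. Qed.

Fact center_subring : subring_closed center_pred.
Proof.
split.
- by apply/center_predP=> y; rewrite mul1r mulr1.
- move=> a b /center_predP ha /center_predP hb; apply/center_predP=> y.
  by rewrite mulrBl mulrBr ha hb.
- move=> a b /center_predP ha /center_predP hb; apply/center_predP=> y.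
  by rewrite -mulrA hb mulrA ha mulrA.
Qed.
HB.instance Definition _ := GRing.isSubringClosed.Build R center_pred center_subring.

Record center := Center { center_val :> R; _ : center_val \in center_pred }.

HB.instance Definition _ := [isSub for center_val].
HB.instance Definition _ := [Choice of center by <:].
HB.instance Definition _ := GRing.SubChoice_isSubPzRing.Build R center_pred center center_subring.

Lemma centerC (c : center) (y : R) : val c * y = y * val c.
Proof. by case: c => c /= /center_predP. Qed.

Fact center_mulC : commutative (fun a b : center => a * b).
Proof. by move=> a b; apply: val_inj; rewrite !rmorphM /= centerC. Qed.
HB.instance Definition _ :=
  GRing.PzRing_hasCommutativeMul.Build center center_mulC.

End Center.

Section Localization.
Variables (R : pzRingType) (p : Spec (center R)).

Record denom := Denom { denom_val :> center R; _ : `[< ~ spec_set p denom_val >] }.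
HB.instance Definition _ := [isSub for denom_val].
HB.instance Definition _ := [Choice of denom by <:].

Lemma denomP (s : denom) : ~ spec_set p (denom_val s).
Proof. by case: s => s hs; apply/asboolP. Qed.

Fact denom1_subproof : `[< ~ spec_set p 1 >].
Proof. by apply/asboolP; case: (specP p). Qed.
Definition denom1 : denom := Denom denom1_subproof.

Fact denomM_subproof (s t : denom) : `[< ~ spec_set p (denom_val s * denom_val t) >].
Proof.
by apply/asboolP; case: (specP p) => _ _ pM /pM [] /denomP.
Qed.
Definition denomM (s t : denom) : denom := Denom (denomM_subproof s t).

(* The pair (a, s) stands for the fraction a / s, and a / s = b / t when      *)
(* u (t a) = u (s b) for some u in the center outside p.                      *)
Local Notation frac := (R * denom)%type.

Definition loc_eqv (x y : frac) : bool :=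
  `[< exists u : denom, val (val u * val y.2) * x.1
                      = val (val u * val x.2) * y.1 >].

Definition loc_addf (x y : frac) : frac :=
  (val (val y.2) * x.1 + val (val x.2) * y.1, denomM x.2 y.2).
Definition loc_oppf (x : frac) : frac := (- x.1, x.2).
Definition loc_mulf (x y : frac) : frac := (x.1 * y.1, denomM x.2 y.2).

Let act (c : center R) (a : R) : R := val c * a.
Local Notation "c ** a" := (act c a) (at level 40, left associativity).

Let actE (c : center R) a : val c * a = c ** a. Proof. by []. Qed.
Let actEE (c d : center R) a : val c * val d * a = (c * d) ** a.
Proof. by rewrite /act rmorphM. Qed.
Let actD c a b : c ** (a + b) = c ** a + c ** b. Proof. exact: mulrDr. Qed.
Let actM c d a : c ** (d ** a) = (c * d) ** a.
Proof. by rewrite /act rmorphM mulrA. Qed.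
Let actl c a b : (c ** a) * b = c ** (a * b). Proof. by rewrite /act mulrA. Qed.
Let actr c a b : a * (c ** b) = c ** (a * b).
Proof. by rewrite /act mulrA -centerC mulrA. Qed.

Let eqvP (x y : frac) : reflect
  (exists u : denom, (val u * val y.2) ** x.1 = (val u * val x.2) ** y.1)
  (loc_eqv x y).
Proof. exact: asboolP. Qed.

Fact loc_eqv_refl : reflexive loc_eqv.
Proof. by move=> x; apply/eqvP; exists denom1. Qed.

Fact loc_eqv_sym : symmetric loc_eqv.
Proof. by move=> x y; apply/eqvP/eqvP => -[u hu]; exists u. Qed.

Fact loc_eqv_trans : transitive loc_eqv.
Proof.
move=> [b t] [a s] [c r] /eqvP[u /= hu] /eqvP[v /= hv].
apply/eqvP; exists (denomM t (denomM u v)) => /=.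
move: hu hv; move: (val t) (val u) (val v) (val s) (val r) => {}t {}u {}v {}s {}r.
move=> hu hv.
have -> : t * (u * v) * r = (v * r) * (u * t) by ring.
rewrite -actM hu actM.
have -> : v * r * (u * s) = (u * s) * (v * r) by ring.
by rewrite -actM hv actM; congr (_ ** _); ring.
Qed.

Canonical loc_eqv_equiv :=
  EquivRel loc_eqv loc_eqv_refl loc_eqv_sym loc_eqv_trans.

Definition localization := {eq_quot loc_eqv}.
HB.instance Definition _ : EqQuotient _ loc_eqv localization :=
  EqQuotient.on localization.
HB.instance Definition _ := Choice.on localization.

Let pi_eq (x y : frac) (u : denom) :
  (val u * val y.2) ** x.1 = (val u * val x.2) ** y.1 ->
  x = y %[mod localization].
Proof. by move=> h; apply/eqmodP/eqvP; exists u. Qed.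

Let pi_repr (x : frac) : exists u : denom,
  let y := repr (\pi_localization x) in
  (val u * val y.2) ** x.1 = (val u * val x.2) ** y.1.
Proof. by apply/eqvP/eqmodP; rewrite reprK. Qed.

Definition loc_add := lift_op2 localization loc_addf.
Definition loc_opp := lift_op1 localization loc_oppf.
Definition loc_mul := lift_op2 localization loc_mulf.
Definition loc_zero : localization := \pi_localization (0, denom1).
Definition loc_one : localization := \pi_localization (1, denom1).

Lemma loc_piD : {morph \pi : x y / loc_addf x y >-> loc_add x y}.
Proof.
move=> x y; unlock loc_add.
have [u] := pi_repr x; have [v] := pi_repr y.
case: (repr (_ y)) => b t /=; case: (repr (_ x)) => a s /=.
case: x y => [a' s'] [b' t'] /= hv hu.
apply: (@pi_eq _ _ (denomM u v)); rewrite /= ?actEE ?actE !actD !actM.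
move: hu hv; move: (val u) (val v) (val s) (val t) (val s') (val t').
move=> {}u {}v {}s {}t {}s' {}t' hu hv; congr (_ + _).
- have -> : u * v * (s * t) * t' = v * t * t' * (u * s) by ring.
  by rewrite -actM hu actM; congr (_ ** _); ring.
- have -> : u * v * (s * t) * s' = u * s * s' * (v * t) by ring.
  by rewrite -actM hv actM; congr (_ ** _); ring.
Qed.

Lemma loc_piN : {morph \pi : x / loc_oppf x >-> loc_opp x}.
Proof.
move=> x; unlock loc_opp; have [u] := pi_repr x.
case: (repr (_ x)) => a s /=; case: x => [a' s'] /= hu.
by apply: (@pi_eq _ _ u); rewrite /= /act !mulrN; congr (- _).
Qed.

Lemma loc_piM : {morph \pi : x y / loc_mulf x y >-> loc_mul x y}.
Proof.
move=> x y; unlock loc_mul.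
have [u] := pi_repr x; have [v] := pi_repr y.
case: (repr (_ y)) => b t /=; case: (repr (_ x)) => a s /=.
case: x y => [a' s'] [b' t'] /= hv hu.
apply: (@pi_eq _ _ (denomM u v)) => /=.
move: hu hv; move: (val u) (val v) (val s) (val t) (val s') (val t').
move=> {}u {}v {}s {}t {}s' {}t' hu hv.
have -> : u * v * (s * t) = (u * s) * (v * t) by ring.
rewrite -actM -actr hv -actl hu actl actr actM.
by congr (_ ** _); ring.
Qed.

Fact loc_addA : associative loc_add.
Proof.
elim/quotW=> x; elim/quotW=> y; elim/quotW=> z; rewrite -!loc_piD.
apply: (@pi_eq _ _ denom1); rewrite /= ?actEE ?actE !actD !actM !addrA.
by congr (_ ** _ + _ ** _ + _ ** _) => /=; ring.
Qed.

Fact loc_addC : commutative loc_add.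
Proof.
elim/quotW=> x; elim/quotW=> y; rewrite -!loc_piD.
apply: (@pi_eq _ _ denom1); rewrite /= ?actEE ?actE !actD !actM addrC.
by congr (_ ** _ + _ ** _) => /=; ring.
Qed.

Fact loc_add0 : left_id loc_zero loc_add.
Proof.
elim/quotW=> x; rewrite /loc_zero -loc_piD.
apply: (@pi_eq _ _ denom1); rewrite /= mulr0 add0r mul1r.
by congr (_ ** _) => /=; ring.
Qed.

Fact loc_addN : left_inverse loc_zero loc_opp loc_add.
Proof.
elim/quotW=> x; rewrite /loc_zero -loc_piN -loc_piD.
by apply: (@pi_eq _ _ denom1); rewrite /= mulrN addNr /act !mulr0.
Qed.

HB.instance Definition _ :=
  GRing.isZmodule.Build localization loc_addA loc_addC loc_add0 loc_addN.

Fact loc_mulA : associative loc_mul.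
Proof.
elim/quotW=> x; elim/quotW=> y; elim/quotW=> z; rewrite -!loc_piM.
apply: (@pi_eq _ _ denom1).
by congr (_ ** _) => /=; [ring | rewrite mulrA].
Qed.

Fact loc_mul1l : left_id loc_one loc_mul.
Proof.
elim/quotW=> x; rewrite /loc_one -loc_piM.
by apply: (@pi_eq _ _ denom1); rewrite /= mul1r; congr (_ ** _) => /=; ring.
Qed.

Fact loc_mul1r : right_id loc_one loc_mul.
Proof.
elim/quotW=> x; rewrite /loc_one -loc_piM.
by apply: (@pi_eq _ _ denom1); rewrite /= mulr1; congr (_ ** _) => /=; ring.
Qed.

Fact loc_mulDl : left_distributive loc_mul loc_add.
Proof.
elim/quotW=> x; elim/quotW=> y; elim/quotW=> z; rewrite -!loc_piD -!loc_piM -loc_piD.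
apply: (@pi_eq _ _ denom1); rewrite /= ?actEE ?actE mulrDl !actl !actD !actM.
by congr (_ ** _ + _ ** _) => /=; ring.
Qed.

Fact loc_mulDr : right_distributive loc_mul loc_add.
Proof.
elim/quotW=> x; elim/quotW=> y; elim/quotW=> z; rewrite -!loc_piD -!loc_piM -loc_piD.
apply: (@pi_eq _ _ denom1); rewrite /= ?actEE ?actE mulrDr !actr !actD !actM.
by congr (_ ** _ + _ ** _) => /=; ring.
Qed.

HB.instance Definition _ := GRing.Zmodule_isPzRing.Build localization
  loc_mulA loc_mul1l loc_mul1r loc_mulDl loc_mulDr.

End Localization.

Section Modules.
Variable A : pzRingType.
Implicit Types M N W : lmodType A.

Definition is_submodule M (S : set M) : Prop :=
  [/\ S 0, forall x y, S x -> S y -> S (x + y)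
    & forall (a : A) x, S x -> S (a *: x)].

(* S is generated, as a submodule of M, by finitely many of its elements. *)
Definition fg_set M (S : set M) : Prop :=
  exists (n : nat) (g : 'I_n -> M), (forall i, S (g i)) /\
    forall x, S x -> exists c : 'I_n -> A, x = \sum_i c i *: g i.

Definition fin_gen M : Prop := fg_set [set: M].

Definition noetherian_module M : Prop :=
  forall S : set M, is_submodule S -> fg_set S.

Definition zero_module M : Prop := forall x : M, x = 0.

Definition surjective M N (f : M -> N) : Prop := forall y, exists x, f x = y.

Definition exact_at L M N (f : L -> M) (g : M -> N) : Prop :=
  forall x : M, g x = 0 <-> exists y : L, f y = x.

Definition short_exact L M N : Prop :=
  exists (f : {linear L -> M}) (g : {linear M -> N}),
    [/\ injective f, exact_at f g & surjective g].

Definition isomorphic M N : Prop := exists f : {linear M -> N}, bijective f.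

Definition projective P : Prop :=
  forall M N (g : {linear M -> N}) (h : {linear P -> N}), surjective g ->
    exists k : {linear P -> M}, forall x, g (k x) = h x.

Record proj_resolution M := ProjResolution {
  res_mod : nat -> lmodType A;
  res_diff : forall i, {linear res_mod i.+1 -> res_mod i};
  res_aug : {linear res_mod 0 -> M};
  res_projective : forall i, projective (res_mod i);
  res_surj : surjective res_aug;
  res_exact0 : exact_at (res_diff 0) res_aug;
  res_exact : forall i, exact_at (res_diff i.+1) (res_diff i) }.

Definition pdim_le M n : Prop :=
  exists P : proj_resolution M, forall i, (n < i)%N -> zero_module (res_mod P i).

Definition gldim_le n : Prop := forall M, pdim_le M n.

Definition gldim_finite : Prop := exists n, gldim_le n.

Section Ext.
Variables (M N : lmodType A) (P : proj_resolution M).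

(* Ext^i(M, N) is the i-th cohomology group, cocycles modulo coboundaries, of *)
(* the complex Hom(P, N). [coboundary] is stated for bare functions because   *)
(* [a *: f] carries no [{linear _ -> _}] structure for a scalar a of A.       *)
Definition cocycle i (f : {linear res_mod P i -> N}) : Prop :=
  forall x, f (res_diff P i x) = 0.

Definition coboundary i : (res_mod P i -> N) -> Prop :=
  if i is j.+1 return (res_mod P i -> N) -> Prop then fun f =>
    exists g : {linear res_mod P j -> N}, forall x, f x = g (res_diff P j x)
  else fun f => forall x, f x = 0.

End Ext.

(* a Ext^i(M, N) = 0 for a central in A: a f is a coboundary for every        *)
(* cocycle f. As Ext does not depend on the resolution P up to isomorphism,   *)
(* quantifying over all P is the same as fixing one.                          *)
Definition kills_Ext (a : A) i M N : Prop :=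
  forall (P : proj_resolution M) (f : {linear res_mod P i -> N}),
    cocycle f -> coboundary (fun x => a *: f x).

(* K is a first syzygy of M: any choice of P and of the surjection is allowed. *)
Definition syzygy1 M K : Prop :=
  exists P, [/\ fin_gen P, projective P & short_exact K P M].

(* K is an n-th syzygy of M, for some sequence of such choices. *)
Fixpoint syzygy n M K : Prop :=
  if n is n'.+1 then exists2 L, syzygy n' M L & syzygy1 L K
  else isomorphic M K.

(* A subcategory of modules is a predicate on [lmodType A] (universe levels   *)
(* do not allow [set (lmodType A)]).                                          *)
Definition subcat := lmodType A -> Prop.

Definition subcat_sub (X Y : subcat) : Prop := forall M, X M -> Y M.

Definition syzygies_of_mod s : subcat :=
  fun K => exists2 M, fin_gen M & syzygy s M K.

Definition syzygies_of G : subcat :=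
  fun K => (exists i, syzygy i G K) \/ (fin_gen K /\ projective K).

Fixpoint dsum k (X : nat -> lmodType A) : lmodType A :=
  if k is k'.+1 then (dsum k' X * X k')%type else 'rV[A]_0.

Definition add_closure (X : subcat) : subcat :=
  fun M => exists k (Y : nat -> lmodType A) W,
    (forall i, (i < k)%N -> X (Y i)) /\ isomorphic (M * W)%type (dsum k Y).

Fixpoint generated (X : subcat) n : subcat :=
  match n with
  | 0 => zero_module
  | 1 => add_closure X
  | n'.+1 => fun M => fin_gen M /\ exists W Y Z,
      [/\ fin_gen W, generated X n' Y, add_closure X Z
        & short_exact Y (M * W)%type Z]
  end.

End Modules.

Section NoetherAlgebra.
Variable L : pzRingType.

Definition noetherian_ring : Prop :=
  @noetherian_module L L^o /\ @noetherian_module L^c L^c^o.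

Definition finite_over_center : Prop :=
  exists (n : nat) (g : 'I_n -> L), forall x : L,
    exists c : 'I_n -> center L, x = \sum_i val (c i) * g i.

Definition noether_algebra : Prop := noetherian_ring /\ finite_over_center.

(* Global dimension is that of right modules, hence the opposite rings. *)
Definition Reg : set (Spec (center L)) :=
  [set p | gldim_finite (localization p)^c].

Definition Sing : set (Spec (center L)) := ~` Reg.

Definition finitistic_gldim_le d : Prop :=
  forall p, Reg p -> gldim_le (localization p)^c d.

Definition ann_Ext i (M N : lmodType L^c) : set (center L) :=
  [set a : center L | kills_Ext (center_val a : L^c) i M N].

Definition ca_ n : set (center L) :=
  [set a | forall (M N : lmodType L^c) i, fin_gen M -> fin_gen N ->
    (n <= i)%N -> ann_Ext i M N a].

Definition ca : set (center L) := \bigcup_n ca_ n.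

End NoetherAlgebra.

Arguments Reg L : clear implicits.
Arguments Sing L : clear implicits.
Arguments ca_ L n : clear implicits.
Arguments ca L : clear implicits.

(* Main.v *)
Require Import Defs.
From HB Require Import structures.
From mathcomp Require Import all_boot all_order all_algebra generic_quotient.
From mathcomp Require Import boolp classical_sets functions.

(* For a central element a, "a kills Ext^(n+1)(M, -)" can be phrased without  *)
(* Ext: multiplication by a on an n-th syzygy of M lifts along surjections.   *)
(* For a = 1 this says that M has projective dimension at most n, so that     *)
(* annihilation of Ext over L and finiteness of the global dimension of a     *)
(* localization become instances of the same predicate. This predicate is     *)
(* stable under direct sums, summands and syzygies, and multiplicative on     *)
(* extensions; hence if a kills Ext^(d+1)(G, Omega^(d+1) G), so that it kills *)
(* Ext^(d+1)(G, -), then a^n kills Ext^(d+1) of every module built from the   *)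
(* syzygies of G in n steps, and therefore Ext^i(M, -) for i > s + d and      *)
(* every finitely generated M. As Hom out of a finitely presented module      *)
(* commutes with localization, some a outside p kills Ext^(n+1)(M, -) if and  *)
(* only if M_p has projective dimension at most n; and the global dimension   *)
(* of L_p is detected on cyclic modules (Auslander). The resulting inclusions *)
(* Sing L <= V(ca) <= V(ca^(s+d+1)) <= V(I) <= Sing L close up.               *)

(** Two facts make the inclusions close up. First, the functor Ext^(j+1)(M, -) is controlled by a
    single class in Ext^(j+1)(M, Omega^(j+1) M), represented by the augmentation of a resolution of
    Omega^(j+1) M: a central element killing this class kills the whole functor. The translations
    are [kills_above_of_kills_Ext] and [kills_Ext_kills_above]. So an element of I kills all of
    Ext^(d+1)(G, -), and [generated_kills_above], through [kills_above_ext], puts a power of it in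
    ca^(s+d+1); a prime containing the power contains the element.

    Secondly, for finitely generated M the predicate [kills_above] can be tested after localization,
    up to a denominator: [localizes_kills_above] and [localizes_kills_above_inv]. If some [a] in
    ca^m lies outside p, it becomes invertible in L_p, so the localizations of finitely generated
    modules, among them all cyclic L_p-modules, have projective dimension at most m, and [auslander]
    bounds the global dimension of L_p by m. Conversely, for regular p the finitistic bound makes
    the projective dimension of G_p at most d, so some [a] outside p kills Ext^(d+1)(G, -) and lies
    in I. *)

Import GRing.Theory.
Local Open Scope ring_scope.
Local Open Scope quotient_scope.
Local Open Scope classical_set_scope.
Set Implicit Arguments.
Unset Strict Implicit.
Unset Printing Implicit Defensive.

(** * Submodules and quotient modules *)

Section Constructions.
Variable A : pzRingType.
Implicit Types M N : lmodType A.

Section LinearPack.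
Variables (M N : lmodType A) (f : M -> N) (fL : linear f).
HB.instance Definition _ := GRing.isLinear.Build A M N *:%R f fL.
Lemma exists_linear : exists F : {linear M -> N}, forall x, F x = f x.
Proof. by exists f. Qed.
(* Sealed, so that simplification never unfolds it. *)
Definition mk_linear : {linear M -> N} := projT1 (cid exists_linear).
Lemma mk_linearE x : mk_linear x = f x.
Proof. by rewrite /mk_linear; case: cid. Qed.
End LinearPack.

Lemma is_submoduleP M (S : set M) : is_submodule S ->
  [/\ S 0, (forall x, S x -> S (- x)), (forall x y, S x -> S y -> S (x + y)),
      (forall x y, S x -> S y -> S (x - y)) & forall a x, S x -> S (a *: x)].
Proof.
case=> S0 SD SZ; have SN x : S x -> S (- x).
  by move=> Sx; rewrite -scaleN1r; apply: SZ.
by split=> // x y Sx Sy; apply: SD => //; apply: SN.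
Qed.

Lemma is_submodule_sum M (S : set M) (I : Type) (r : seq I) (P : pred I) (F : I -> M) :
  is_submodule S -> (forall i, S (F i)) -> S (\sum_(i <- r | P i) F i).
Proof. by case=> S0 SD _ SF; apply: big_ind. Qed.

Section Submodule.
Variables (M : lmodType A) (S : set M) (hS : is_submodule S).

(** Taking the proof as an argument makes it part of the term [sub_pred hS], from which unification
    recovers it when it looks for the closure instance. *)
Definition sub_pred of is_submodule S : pred M := fun x => `[< S x >].

Lemma sub_predP x : reflect (S x) (x \in sub_pred hS).
Proof. exact: asboolP. Qed.

Fact sub_pred_submod : submod_closed (sub_pred hS).
Proof.
have [S0 _ SD _ SZ] := is_submoduleP hS; split; first exact/sub_predP.
by move=> a x y /sub_predP Sx /sub_predP Sy; apply/sub_predP/SD => //; apply: SZ.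
Qed.
HB.instance Definition _ := GRing.isSubmodClosed.Build A M (sub_pred hS) sub_pred_submod.

Record submod := Submod { submod_val :> M; _ : submod_val \in sub_pred hS }.
HB.instance Definition _ := [isSub for submod_val].
HB.instance Definition _ := [Choice of submod by <:].
HB.instance Definition _ := [SubChoice_isSubLmodule of submod by <:].

Lemma submodP (u : submod) : S (val u).
Proof. by case: u => u /= /sub_predP. Qed.

Definition submod_inj : {linear submod -> M} := mk_linear (fun a u v => linearP val a u v).

Lemma submodE (u : submod) : submod_inj u = val u. Proof. exact: mk_linearE. Qed.

Lemma submod_lift N (f : {linear N -> M}) : (forall x, S (f x)) ->
  exists F : {linear N -> submod}, forall x, val (F x) = f x.
Proof.
move=> Sf; have Sf' x : f x \in sub_pred hS by apply/sub_predP.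
have FL : linear (fun x => Submod (Sf' x)).
  by move=> a x y; apply: val_inj; rewrite /= linearP.
by exists (mk_linear FL) => x; rewrite mk_linearE.
Qed.

Lemma submod_ex x : S x -> exists u : submod, val u = x.
Proof. by move=> /sub_predP Sx; exists (Submod Sx). Qed.

End Submodule.

Section Quotient.
Variables (M : lmodType A) (S : set M) (hS : is_submodule S).

(** Choosing one representative per coset makes the quotient a subtype of [M], which inherits its
    choice structure. *)
Definition coset_repr of is_submodule S := fun x : M => choose (fun y => `[< S (y - x) >]) x.

Lemma coset_reprP x : S (coset_repr hS x - x).
Proof.
apply/asboolP/(@chooseP _ (fun y => `[< S (y - x) >])).
by apply/asboolP; rewrite subrr; case: hS.
Qed.

Lemma eq_coset_repr x y : S (x - y) -> coset_repr hS x = coset_repr hS y.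
Proof.
have [S0 SN SD SB SZ] := is_submoduleP hS => Sxy.
rewrite /coset_repr.
have eP : (fun z => `[< S (z - x) >]) =1 (fun z => `[< S (z - y) >]).
  move=> z; apply/asboolP/asboolP => Sz.
    by rewrite -(subrK x z) -addrA; apply: SD.
  by rewrite -(subrK y z) -addrA; apply: SD => //; rewrite -opprB; apply: SN.
rewrite (eq_choose eP); apply: choose_id; apply/asboolP => //.
by rewrite subrr.
Qed.

Record quot := Quot { quot_val : M; _ : coset_repr hS quot_val == quot_val }.
HB.instance Definition _ := [isSub for quot_val].
HB.instance Definition _ := [Choice of quot by <:].

Lemma coset_repr_id x : coset_repr hS (coset_repr hS x) == coset_repr hS x.
Proof. by apply/eqP/eq_coset_repr/coset_reprP. Qed.

Definition quot_pi x : quot := Quot (coset_repr_id x).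

Lemma quot_piK u : quot_pi (val u) = u.
Proof. by apply: val_inj => /=; case: u => u /= /eqP. Qed.

Lemma quot_piP x y : quot_pi x = quot_pi y <-> S (x - y).
Proof.
have [S0 SN SD SB SZ] := is_submoduleP hS; split => [/(congr1 val)/= exy|Sxy].
  have := SB _ _ (coset_reprP y) (coset_reprP x).
  by rewrite exy opprB addrC addrA subrK.
by apply: val_inj; apply: eq_coset_repr.
Qed.

Lemma quotW (P : quot -> Prop) : (forall x, P (quot_pi x)) -> forall u, P u.
Proof. by move=> h u; rewrite -(quot_piK u). Qed.

Let qadd (u v : quot) := quot_pi (val u + val v).
Let qopp (u : quot) := quot_pi (- val u).
Let qscale a (u : quot) := quot_pi (a *: val u).

Let qaddE x y : qadd (quot_pi x) (quot_pi y) = quot_pi (x + y).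
Proof.
have [S0 SN SD SB SZ] := is_submoduleP hS; apply/quot_piP => /=.
by rewrite opprD addrACA; apply: SD; apply: coset_reprP.
Qed.
Let qoppE x : qopp (quot_pi x) = quot_pi (- x).
Proof.
have [S0 SN SD SB SZ] := is_submoduleP hS; apply/quot_piP => /=.
by rewrite -opprD; apply/SN/coset_reprP.
Qed.
Let qscaleE a x : qscale a (quot_pi x) = quot_pi (a *: x).
Proof.
have [S0 SN SD SB SZ] := is_submoduleP hS; apply/quot_piP => /=.
by rewrite -scalerBr; apply/SZ/coset_reprP.
Qed.

Fact qaddA : associative qadd.
Proof. by elim/quotW=> x; elim/quotW=> y; elim/quotW=> z; rewrite !qaddE addrA. Qed.
Fact qaddC : commutative qadd.
Proof. by elim/quotW=> x; elim/quotW=> y; rewrite !qaddE addrC. Qed.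
Fact qadd0 : left_id (quot_pi 0) qadd.
Proof. by elim/quotW=> x; rewrite !qaddE add0r. Qed.
Fact qaddN : left_inverse (quot_pi 0) qopp qadd.
Proof. by elim/quotW=> x; rewrite qoppE !qaddE addNr. Qed.
HB.instance Definition _ := GRing.isZmodule.Build quot qaddA qaddC qadd0 qaddN.

Fact qscaleA a b u : qscale a (qscale b u) = qscale (a * b) u.
Proof. by elim/quotW: u => x; rewrite !qscaleE scalerA. Qed.
Fact qscale1 : left_id 1 qscale.
Proof. by elim/quotW=> x; rewrite !qscaleE scale1r. Qed.
Fact qscaleDr : right_distributive qscale +%R.
Proof.
move=> a; elim/quotW=> x; elim/quotW=> y.
by rewrite -[LHS]/(qscale _ (qadd _ _)) -[RHS]/(qadd _ _) !(qscaleE, qaddE) scalerDr.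
Qed.
Fact qscaleDl u : {morph qscale^~ u : a b / a + b}.
Proof.
elim/quotW: u => x a b.
by rewrite -[RHS]/(qadd _ _) !(qscaleE, qaddE) scalerDl.
Qed.
HB.instance Definition _ :=
  GRing.Zmodule_isLmodule.Build A quot qscaleA qscale1 qscaleDr qscaleDl.

Fact quot_pi_linear : linear quot_pi.
Proof.
move=> a x y.
by rewrite -[RHS]/(qadd (qscale _ _) _) qscaleE qaddE.
Qed.

Definition quot_proj : {linear M -> quot} := mk_linear quot_pi_linear.

Lemma quot_projE x : quot_proj x = quot_pi x. Proof. exact: mk_linearE. Qed.

Lemma quot_proj_surj : surjective quot_proj.
Proof. by elim/quotW => x; exists x; rewrite quot_projE. Qed.

Lemma quot_proj_eq0 x : quot_proj x = 0 <-> S x.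
Proof. by rewrite quot_projE -{2}(subr0 x); exact: quot_piP. Qed.

End Quotient.
End Constructions.

(** * Functorial covers by projective modules *)

Section Cover.
Variable A : pzRingType.
Variable M : lmodType A.

(* The value at 0 is killed so that [cover] turns the zero module into the   *)
(* zero module.                                                              *)
Definition finsupp0 : set (M -> A^o) :=
  [set phi | phi 0 = 0 /\ exists s : seq M, forall x, x \notin s -> phi x = 0].

Lemma finsupp0_submodule : is_submodule finsupp0.
Proof.
split=> [|phi psi [phi0 [s hs]] [psi0 [t ht]]|a phi [phi0 [s hs]]].
- by split=> //; exists [::].
- split; first by rewrite /GRing.add/= phi0 psi0 addr0.
  exists (s ++ t) => x; rewrite mem_cat negb_or => /andP[xs xt].
  by rewrite /GRing.add/= hs // ht // addr0.
- split; first by rewrite /GRing.scale/= phi0 scaler0.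
  by exists s => x xs; rewrite /GRing.scale/= hs // scaler0.
Qed.

(** The free module on the nonzero elements of [M], with basis vectors [delta s]. It involves no
    choice of generators, so submodules of [M] have comparable syzygies inside it. *)
Definition cover : lmodType A := submod finsupp0_submodule.

Definition coef (phi : cover) (x : M) : A := (val phi : M -> A^o) x.

Lemma coefD phi psi x : coef (phi + psi) x = coef phi x + coef psi x.
Proof. by []. Qed.
Lemma coefN phi x : coef (- phi) x = - coef phi x.
Proof. by []. Qed.
Lemma coefZ a phi x : coef (a *: phi) x = a * coef phi x.
Proof. by []. Qed.
Lemma coef0 x : coef 0 x = 0. Proof. by []. Qed.
Lemma coef_at0 phi : coef phi 0 = 0.
Proof. by case: (submodP phi). Qed.
Lemma coef_inj phi psi : (forall x, coef phi x = coef psi x) -> phi = psi.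
Proof. by move=> h; apply/val_inj/funext. Qed.
Lemma coef_sum (I : Type) (r : seq I) (F : I -> cover) x :
  coef (\sum_(i <- r) F i) x = \sum_(i <- r) coef (F i) x.
Proof. by elim/big_rec2: _ => // i u v _ <-; rewrite coefD. Qed.

Lemma cover_ex (f : M -> A) : f 0 = 0 ->
  (exists s : seq M, forall x, x \notin s -> f x = 0) ->
  exists phi : cover, forall x, coef phi x = f x.
Proof.
move=> f0 fs; have [|phi ephi] := @submod_ex _ _ _ finsupp0_submodule f.
  by split.
by exists phi => x; rewrite /coef ephi.
Qed.

Lemma supp_ex (phi : cover) :
  exists s : seq M, uniq s /\ forall x, x \notin s -> coef phi x = 0.
Proof.
have [_ [s hs]] := submodP phi; exists (undup s); rewrite undup_uniq.
by split=> // x; rewrite mem_undup => /hs.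
Qed.

Definition supp phi : seq M := projT1 (cid (supp_ex phi)).
Lemma supp_uniq phi : uniq (supp phi).
Proof. by rewrite /supp; case: cid => s []. Qed.
Lemma suppP phi x : x \notin supp phi -> coef phi x = 0.
Proof. by rewrite /supp; case: cid => s [? h] /h. Qed.

(** The linear extension of [g] from the basis [delta]. The list [supp phi] is only some list
    containing the support; [evalE] gives independence of it. *)
Definition eval (N : lmodType A) (g : M -> N) (phi : cover) : N :=
  \sum_(x <- supp phi) coef phi x *: g x.

Lemma eval_widen (N : lmodType A) (f : M -> A) (g : M -> N) (s t : seq M) :
  uniq s -> uniq t -> {subset s <= t} ->
  (forall x, x \notin s -> f x = 0) ->
  \sum_(x <- t) f x *: g x = \sum_(x <- s) f x *: g x.
Proof.
move=> us ut st f0.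
rewrite (bigID (mem s)) /= [X in _ + X]big1 ?addr0; last first.
  by move=> i /f0 ->; rewrite scale0r.
rewrite -big_filter; apply: perm_big; apply: uniq_perm => //.
  exact: filter_uniq.
by move=> x; rewrite mem_filter; case xs: (x \in s) => //=; apply: st.
Qed.

Lemma evalE (N : lmodType A) (g : M -> N) (phi : cover) (s : seq M) : uniq s ->
  (forall x, x \notin s -> coef phi x = 0) ->
  eval g phi = \sum_(x <- s) coef phi x *: g x.
Proof.
move=> us hs; pose t := undup (supp phi ++ s).
have tu : uniq t by exact: undup_uniq.
rewrite -(@eval_widen N (coef phi) g s t us tu _ hs); last first.
  by move=> x xs; rewrite mem_undup mem_cat xs orbT.
rewrite /eval -(@eval_widen N (coef phi) g _ t (supp_uniq phi) tu _ (@suppP phi)) //.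
by move=> x xs; rewrite mem_undup mem_cat xs.
Qed.

Lemma eval_linear (N : lmodType A) (g : M -> N) : linear (eval g).
Proof.
move=> a phi psi; pose t := undup (supp phi ++ supp psi).
have tu : uniq t by exact: undup_uniq.
have h1 x : x \notin t -> coef phi x = 0.
  by rewrite mem_undup mem_cat negb_or => /andP[/suppP].
have h2 x : x \notin t -> coef psi x = 0.
  by rewrite mem_undup mem_cat negb_or => /andP[_ /suppP].
have h3 x : x \notin t -> coef (a *: phi + psi) x = 0.
  by move=> xt; rewrite coefD coefZ h1 // h2 // mulr0 addr0.
rewrite !(evalE g tu) // scaler_sumr -big_split/=.
by apply: eq_bigr => x _; rewrite coefD coefZ scalerDl scalerA.
Qed.

Definition evalL (N : lmodType A) (g : M -> N) : {linear cover -> N} := mk_linear (eval_linear g).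
Lemma evalLE (N : lmodType A) (g : M -> N) phi : evalL g phi = eval g phi.
Proof. exact: mk_linearE. Qed.

Lemma delta_subproof (s : M) : finsupp0 (fun x => ((x == s) && (s != 0))%:R).
Proof.
split; first by case: eqP => // <-; rewrite eqxx.
by exists [:: s] => x; rewrite inE => /negbTE ->.
Qed.
Definition delta (s : M) : cover := Submod (introT (sub_predP _ _) (delta_subproof s)).

Lemma coef_delta s x : coef (delta s) x = ((x == s) && (s != 0))%:R.
Proof. by []. Qed.

Lemma eval_delta (N : lmodType A) (g : M -> N) s : s != 0 -> eval g (delta s) = g s.
Proof.
move=> s0; rewrite (@evalE _ _ _ [:: s]) // => [|x].
  by rewrite big_seq1 coef_delta eqxx s0 scale1r.
by rewrite inE coef_delta => /negbTE ->.
Qed.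

Lemma eval_delta_id s : eval id (delta s) = s.
Proof.
have [->|] := eqVneq s 0; last exact: eval_delta.
rewrite /eval big1 // => x _; by rewrite coef_delta eqxx andbF scale0r.
Qed.

Lemma eval_self phi : eval delta phi = phi.
Proof.
apply: coef_inj => x; rewrite /eval coef_sum.
under eq_bigr => y _ do rewrite coefZ coef_delta.
have [->|x0] := eqVneq x 0.
  rewrite coef_at0 big1 // => y _.
  by case: eqP => [<-|]; rewrite ?eqxx mulr0.
have [xs|xs] := boolP (x \in supp phi); last first.
  rewrite suppP // big_seq big1 // => y ys.
  by case: eqP => [exy|]; rewrite ?mulr0 //; rewrite exy ys in xs.
rewrite (bigD1_seq x) ?supp_uniq //= eqxx x0 mulr1 big1 ?addr0 // => y /negbTE yx.
by rewrite eq_sym yx mulr0.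
Qed.

Lemma linear_eval (N : lmodType A) (h : {linear cover -> N}) phi : h phi = eval (h \o delta) phi.
Proof.
rewrite -{1}(eval_self phi) /eval linear_sum.
by apply: eq_bigr => x _; rewrite linearZ.
Qed.

Lemma cover_projective : projective cover.
Proof.
move=> X Y g h gs.
have /choice[k0 hk0] : forall x, exists y, g y = h (delta x) by move=> x; apply: gs.
exists (evalL k0) => phi; rewrite [RHS]linear_eval evalLE /eval linear_sum.
by apply: eq_bigr => x _; rewrite linearZ hk0.
Qed.

Definition cover_map : {linear cover -> M} := evalL id.

Lemma cover_mapE phi : cover_map phi = eval id phi. Proof. exact: mk_linearE. Qed.

Lemma cover_map_surj : surjective cover_map.
Proof. by move=> x; exists (delta x); rewrite cover_mapE; exact: eval_delta_id. Qed.

End Cover.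

(** * Annihilation of Ext and projective dimension *)

Section Maps.
Variable A : pzRingType.
Implicit Types K M N P X Y : lmodType A.

Lemma zero_linear M N : linear (fun _ : M => 0 : N).
Proof. by move=> a x y; rewrite scaler0 addr0. Qed.

Lemma id_linear M : linear (fun x : M => x). Proof. by []. Qed.

Lemma comp_linear M N P (f : {linear N -> P}) (g : {linear M -> N}) :
  linear (fun x => f (g x)).
Proof. by move=> a x y; rewrite !linearP. Qed.

Lemma add_linear M N (f g : {linear M -> N}) : linear (fun x => f x + g x).
Proof. by move=> a x y; rewrite !linearP scalerDr addrACA. Qed.

Lemma sub_linear M N (f g : {linear M -> N}) : linear (fun x => f x - g x).
Proof. by move=> a x y; rewrite !linearP scalerDr addrACA. Qed.

Lemma fst_linear M N : linear (fun x : (M * N)%type => x.1).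
Proof. by []. Qed.
Lemma snd_linear M N : linear (fun x : (M * N)%type => x.2).
Proof. by []. Qed.
Lemma pair_linear M N P (f : {linear P -> M}) (g : {linear P -> N}) :
  linear (fun x => (f x, g x) : (M * N)%type).
Proof. by move=> a x y; rewrite !linearP. Qed.

Definition fstL M N : {linear (M * N)%type -> M} := mk_linear (@fst_linear M N).
Definition sndL M N : {linear (M * N)%type -> N} := mk_linear (@snd_linear M N).
Definition pairL M N P (f : {linear P -> M}) (g : {linear P -> N}) :
  {linear P -> (M * N)%type} := mk_linear (pair_linear f g).
Definition idL M : {linear M -> M} := mk_linear (@id_linear M).
Definition zeroL M N : {linear M -> N} := mk_linear (@zero_linear M N).
Definition compL M N P (f : {linear N -> P}) (g : {linear M -> N}) : {linear M -> P} :=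
  mk_linear (comp_linear f g).
Definition addL M N (f g : {linear M -> N}) : {linear M -> N} := mk_linear (add_linear f g).
Definition subL M N (f g : {linear M -> N}) : {linear M -> N} := mk_linear (sub_linear f g).

Definition central (a : A) := forall b : A, a * b = b * a.

Lemma scale_linear (a : A) (ac : central a) M : linear (fun x : M => a *: x).
Proof. by move=> b x y; rewrite scalerDr !scalerA ac. Qed.
Definition scaleL (a : A) (ac : central a) M : {linear M -> M} :=
  mk_linear (@scale_linear a ac M).

Lemma central1 : central 1. Proof. by move=> b; rewrite mul1r mulr1. Qed.
Lemma centralM a b : central a -> central b -> central (a * b).
Proof. by move=> ac bc x; rewrite -mulrA bc mulrA ac mulrA. Qed.

Section LinE.
Variables (M N P Q : lmodType A).
Lemma idLE x : idL M x = x. Proof. exact: mk_linearE. Qed.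
Lemma zeroLE x : zeroL M N x = 0. Proof. exact: mk_linearE. Qed.
Lemma compLE (f : {linear N -> P}) (g : {linear M -> N}) x : compL f g x = f (g x).
Proof. exact: mk_linearE. Qed.
Lemma addLE (f g : {linear M -> N}) x : addL f g x = f x + g x. Proof. exact: mk_linearE. Qed.
Lemma subLE (f g : {linear M -> N}) x : subL f g x = f x - g x. Proof. exact: mk_linearE. Qed.
Lemma fstLE x : fstL M N x = x.1. Proof. exact: mk_linearE. Qed.
Lemma sndLE x : sndL M N x = x.2. Proof. exact: mk_linearE. Qed.
Lemma pairLE (f : {linear P -> M}) (g : {linear P -> N}) x : pairL f g x = (f x, g x).
Proof. exact: mk_linearE. Qed.
Lemma scaleLE a (ac : central a) x : scaleL ac M x = a *: x. Proof. exact: mk_linearE. Qed.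
End LinE.

Definition linE := (idLE, zeroLE, compLE, addLE, subLE, fstLE, sndLE, pairLE, scaleLE).

Lemma lift_inj K P N (f : {linear K -> P}) (u : {linear N -> P}) : injective f ->
  (forall x, exists y, f y = u x) -> exists v : {linear N -> K}, forall x, f (v x) = u x.
Proof.
move=> fI /choice[v hv]; have vL : linear v.
  by move=> a x y; apply: fI; rewrite linearP !hv linearP.
by exists (mk_linear vL) => x; rewrite mk_linearE.
Qed.

Lemma descend P M N (g : {linear P -> M}) (u : {linear P -> N}) : surjective g ->
  (forall x, g x = 0 -> u x = 0) -> exists v : {linear M -> N}, forall x, v (g x) = u x.
Proof.
move=> gs gu; have /choice[s hs] : forall y, exists x, g x = y by [].
have gu' x y : g x = g y -> u x = u y.
  move=> e; apply/eqP; rewrite -subr_eq0 -linearB; apply/eqP/gu.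
  by rewrite linearB e subrr.
have vL : linear (fun x => u (s x)).
  by move=> a x y; rewrite -linearP; apply: gu'; rewrite linearP !hs.
by exists (mk_linear vL) => x; rewrite mk_linearE; apply: gu'; rewrite hs.
Qed.

Lemma isomorphicP M N : isomorphic M N ->
  exists (f : {linear M -> N}) (g : {linear N -> M}), cancel f g /\ cancel g f.
Proof.
case=> f [g fK gK]; have gL : linear g.
  by move=> a x y; apply: (can_inj fK); rewrite linearP !gK.
by exists f, (mk_linear gL); split=> x; rewrite mk_linearE.
Qed.

Lemma isomorphic_intro M N (f : {linear M -> N}) (g : {linear N -> M}) :
  cancel f g -> cancel g f -> isomorphic M N.
Proof. by move=> fK gK; exists f; exists g. Qed.

Lemma isomorphic_refl M : isomorphic M M.
Proof. by apply: (@isomorphic_intro _ _ (idL M) (idL M)) => x; rewrite !linE. Qed.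

Lemma isomorphic_sym M N : isomorphic M N -> isomorphic N M.
Proof. by move=> /isomorphicP[f [g [fK gK]]]; exact: isomorphic_intro gK fK. Qed.

Definition kerset P M (g : {linear P -> M}) : set P := [set x | g x = 0].

Lemma ker_submodule P M (g : {linear P -> M}) : is_submodule (kerset g).
Proof.
split=> [|x y hx hy|a x hx]; rewrite /kerset ?linE /= ?linE ?linear0 ?linearD ?linearZ/=.
- by [].
- by rewrite hx hy addr0.
- by rewrite hx scaler0.
Qed.

Definition kermod P M (g : {linear P -> M}) : lmodType A := submod (ker_submodule g).
Definition ker_inj P M (g : {linear P -> M}) : {linear kermod g -> P} :=
  submod_inj (ker_submodule g).

Lemma ker_injE P M (g : {linear P -> M}) x : ker_inj g x = val x.
Proof. exact: submodE. Qed.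

Lemma ker_inj_inj P M (g : {linear P -> M}) : injective (ker_inj g).
Proof. by move=> x y; rewrite !ker_injE => /val_inj. Qed.

Lemma ker_exact_at P M (g : {linear P -> M}) : exact_at (ker_inj g) g.
Proof.
move=> x; split=> [gx|[y <-]]; last by rewrite ker_injE; exact: (submodP y).
by have [u <-] := submod_ex (ker_submodule g) gx; exists u; rewrite ker_injE.
Qed.

Lemma ker_short_exact P M (g : {linear P -> M}) : surjective g ->
  short_exact (kermod g) P M.
Proof.
by move=> gs; exists (ker_inj g), g; split=> //; [exact: ker_inj_inj|exact: ker_exact_at].
Qed.

Lemma short_exact_isol K K' P M : isomorphic K K' -> short_exact K P M -> short_exact K' P M.
Proof.
move=> /isomorphicP[u [v [uK vK]]] [f [g [fI fg gs]]].
exists (compL f v), g; split=> //.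
  by move=> x y; rewrite !linE => /fI /(can_inj vK).
move=> x; rewrite fg; split=> -[y <-]; rewrite ?linE; first by exists (u y); rewrite ?linE /= uK.
by exists (v y).
Qed.

Lemma short_exact_isor P K M M' : isomorphic M M' -> short_exact K P M -> short_exact K P M'.
Proof.
move=> /isomorphicP[u [v [uK vK]]] [f [g [fI fg gs]]].
exists f, (compL u g); split=> //.
  move=> x; rewrite -fg !linE; split=> [e|->]; last by rewrite linear0.
  by rewrite -(uK (g x)) e linear0.
by move=> y; have [x hx] := gs (v y); exists x; rewrite ?linE /= hx vK.
Qed.

Lemma zero_module_rV0 : zero_module 'rV[A]_0.
Proof. by move=> x; exact: thinmx0. Qed.

End Maps.

(** * Dimension shifting for [kills_above]: summands, Schanuel's lemma, extensions *)

Section Epd.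
Variable A : pzRingType.
Implicit Types (a b : A) (K M N P X Y Z : lmodType A).

(* For central a this says that a kills Ext^1(M, -); for a = 1 it is          *)
(* projectivity of M.                                                         *)
Definition aprojective a M : Prop :=
  forall X Y (g : {linear X -> Y}) (h : {linear M -> Y}), surjective g ->
    exists k : {linear M -> X}, forall x, g (k x) = a *: h x.

(* For central a this says that a kills Ext^{n+1}(M, -); for a = 1, that M    *)
(* has projective dimension at most n.                                        *)
Fixpoint kills_above a n M : Prop :=
  if n is n'.+1 then forall K P, projective P -> short_exact K P M -> kills_above a n' K
  else aprojective a M.

Lemma projective_aprojective a M : central a -> projective M -> aprojective a M.
Proof.
move=> ac Mp X Y g h gs; have [k hk] := Mp _ _ _ h gs.
by exists (compL k (scaleL ac M)) => x; rewrite !linE hk linearZ.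
Qed.

Lemma aprojective1 M : aprojective 1 M -> projective M.
Proof.
move=> Mp X Y g h gs; have [k hk] := Mp _ _ _ h gs.
by exists k => x; rewrite hk scale1r.
Qed.

Definition retract M X := exists (i : {linear M -> X}) (r : {linear X -> M}), cancel i r.

Lemma aprojective_retract a M X : retract M X -> aprojective a X -> aprojective a M.
Proof.
move=> [i [r ir]] Xp U V g h gs; have [k hk] := Xp _ _ g (compL h r) gs.
by exists (compL k i) => x; rewrite !linE hk !linE ir.
Qed.

Lemma aprojective_prod a M N : aprojective a M -> aprojective a N ->
  aprojective a (M * N)%type.
Proof.
move=> Mp Np X Y g h gs.
have [k hk] := Mp _ _ g (compL h (pairL (idL M) (zeroL M N))) gs.
have [l hl] := Np _ _ g (compL h (pairL (zeroL N M) (idL N))) gs.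
exists (addL (compL k (fstL M N)) (compL l (sndL M N))) => -[x y].
rewrite !linE  linearD hk hl !linE -scalerDr -linearD.
by rewrite /GRing.add /= /add_pair /= addr0 add0r.
Qed.

Lemma projective_prod M N : projective M -> projective N -> projective (M * N)%type.
Proof.
move=> Mp Np; apply/aprojective1/aprojective_prod; apply: projective_aprojective => //;
  exact: central1.
Qed.

Lemma zero_aprojective a M : zero_module M -> aprojective a M.
Proof.
move=> M0 X Y g h gs; exists (zeroL M X) => x.
by rewrite (M0 x) !linear0 scaler0.
Qed.

(** A presentation of the retract [M] by [P] is compared with the cover of [X] by P + cover X,
    sending (p, c) to i (g p) + q c. With [t] lifting [r q] through [g], the maps x -> (f x, 0) and
    (p, c) -> p + t c make [K] a retract of its kernel. *)
Lemma kills_above_retract a n M X : retract M X -> kills_above a n X -> kills_above a n M.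
Proof.
elim: n => [|n IH] in M X *; first exact: aprojective_retract.
move=> [i [r ir]] Xn K P Pp [f [g [fI fg gs]]].
pose q := cover_map X.
have [t ht] := @cover_projective A X _ _ g (compL r q) gs.
pose w := addL (compL (compL i g) (fstL P (cover X))) (compL q (sndL P (cover X))).
have ws : surjective w.
  by move=> x; have [c hc] := cover_map_surj x; exists (0, c); rewrite ?linE /= !linear0 add0r.
apply: IH (Xn _ _ (projective_prod Pp (@cover_projective A X)) (ker_short_exact ws)).
have [u hu] : exists u : {linear K -> kermod w},
    forall x, val (u x) = pairL f (zeroL K (cover X)) x.
  apply: submod_lift => x; rewrite /kerset /= /w ?linE /=.
  rewrite linear0 addr0.
  suff -> : g (f x) = 0 by rewrite linear0.
  by apply/fg; exists x.
pose z := addL (fstL P (cover X)) (compL t (sndL P (cover X))).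
have [|v hv] := @lift_inj A _ _ _ f (compL z (ker_inj w)) fI.
  move=> x; apply/fg; rewrite ?linE ker_injE linearD ht ?linE.
  have := submodP x; rewrite /kerset /= /w ?linE /= => /(congr1 r).
  by rewrite linearD ir linear0.
by exists u, v => x; apply: fI; rewrite hv ?linE ker_injE hu ?linE /= linear0 addr0.
Qed.

Lemma kills_above_iso a n M N : isomorphic M N -> kills_above a n M -> kills_above a n N.
Proof.
move=> /isomorphicP[f [g [fK gK]]]; apply: kills_above_retract.
by exists g, f.
Qed.

Lemma short_exact_prod K P M K' P' M' : short_exact K P M -> short_exact K' P' M' ->
  short_exact (K * K')%type (P * P')%type (M * M')%type.
Proof.
move=> [f [g [fI fg gs]]] [f' [g' [fI' fg' gs']]].
exists (pairL (compL f (fstL K K')) (compL f' (sndL K K'))).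
exists (pairL (compL g (fstL P P')) (compL g' (sndL P P'))).
split=> [[x y] [x' y']|[x y]|[x y]].
- by rewrite !linE /= => -[/fI -> /fI' ->].
- rewrite !linE /=; split=> [[/fg[u <-] /fg'[v <-]]|[[u v]]].
    by exists (u, v); rewrite !linE.
  rewrite !linE /= => -[<- <-].
  by congr (_, _); [apply/fg; exists u|apply/fg'; exists v].
- have [u <-] := gs x; have [v <-] := gs' y.
  by exists (u, v); rewrite !linE.
Qed.

(** A surjection onto a projective module splits, so its kernel is a retract of [P] and again
    projective. *)
Lemma projective_kills_above a n M : central a -> projective M -> kills_above a n M.
Proof.
move=> ac; elim: n => [|n IH] in M *; first exact: projective_aprojective.
move=> Mp K P Pp [f [g [fI fg gs]]]; apply: IH.
have [s hs] := Mp _ _ g (idL M) gs.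
apply/aprojective1/(@aprojective_retract _ _ P).
  have [|r hr] := @lift_inj A _ _ _ f (subL (idL P) (compL s g)) fI.
    by move=> x; apply/fg; rewrite !linE linearB hs !linE subrr.
  exists f, r => x; apply: fI; rewrite hr !linE.
  suff -> : g (f x) = 0 by rewrite linear0 subr0.
  by apply/fg; exists x.
exact: projective_aprojective (@central1 A) Pp.
Qed.

(** Half of Schanuel's isomorphism, enough because [kills_above] passes to retracts. If [v] lifts
    [g'] through [g] and [u] lifts [g] through [g'], then [K'] embeds by x -> (- v (f' x), f' x),
    and (x, y) -> y - u (f x + v y) is a retraction onto it. *)
Lemma schanuel K P M K' P' : projective P -> projective P' ->
  short_exact K P M -> short_exact K' P' M -> retract K' (K * P')%type.
Proof.
move=> Pp Pp' [f [g [fI fg gs]]] [f' [g' [fI' fg' gs']]].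
have [u hu] := Pp _ _ g' g gs'; have [v hv] := Pp' _ _ g g' gs.
have gf x : g (f x) = 0 by apply/fg; exists x.
have gf' x : g' (f' x) = 0 by apply/fg'; exists x.
have [|i hi] := @lift_inj A _ _ _ f (compL v f') fI.
  by move=> x; apply/fg; rewrite ?linE /= hv gf'.
pose z := addL (compL f (fstL K P')) (compL v (sndL K P')).
have [|r hr] := @lift_inj A _ _ _ f' (subL (sndL K P') (compL u z)) fI'.
  by move=> x; apply/fg'; rewrite !linE linearB hu linearD gf add0r hv subrr.
exists (pairL (subL (zeroL K' K) i) f'), r => x; apply: fI'.
by rewrite hr !linE /= sub0r linearN hi !linE addNr linear0 subr0.
Qed.

Lemma kills_above_prod a n M N : central a ->
  kills_above a n M -> kills_above a n N -> kills_above a n (M * N)%type.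
Proof.
move=> ac; elim: n => [|n IH] in M N *; first exact: aprojective_prod.
move=> Mn Nn K P Pp KPM.
have cM := @cover_projective A M; have cN := @cover_projective A N.
have eM := ker_short_exact (@cover_map_surj A M).
have eN := ker_short_exact (@cover_map_surj A N).
apply: kills_above_retract (schanuel (projective_prod cM cN) Pp (short_exact_prod eM eN) KPM) _.
by apply: (IH); [apply: (IH); [exact: Mn eM|exact: Nn eN]|exact: projective_kills_above].
Qed.

(** By Schanuel, one syzygy decides for all: [kills_above] quantifies over every presentation, but
    any other syzygy is a retract of [K] plus a projective module. *)
Lemma kills_aboveS a n K P M : central a -> projective P -> short_exact K P M ->
  kills_above a n K -> kills_above a n.+1 M.
Proof.
move=> ac Pp e Kn K' P' Pp' e'; apply: kills_above_retract (schanuel Pp Pp' e e') _.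
by apply: kills_above_prod => //; exact: projective_kills_above.
Qed.

Lemma kills_above_weaken a n M : central a -> kills_above a n M -> kills_above a n.+1 M.
Proof.
move=> ac; elim: n => [|n IH] in M *; last first.
  by move=> Mn K P Pp e; apply: IH; exact: Mn e.
move=> Mp K P Pp [f [g [fI fg gs]]] X Y q h qs.
have [k hk] := Mp _ _ g (idL M) gs.
(* Since [g k] is multiplication by [a], the map a - k g sends [P] into [K] and restricts to
   multiplication by [a] on [K]; so [a *: h] extends to [P], where it can be lifted. *)
have [|r hr] := @lift_inj A _ _ _ f (subL (scaleL ac P) (compL k g)) fI.
  by move=> x; apply/fg; rewrite !linE linearB linearZ hk !linE; exact: subrr.
have [l hl] := Pp _ _ q (compL h r) qs.
exists (compL l f) => x; rewrite !linE hl !linE -linearZ; congr (h _); apply: fI.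
rewrite hr !linE; suff -> : g (f x) = 0 by rewrite linear0 subr0 linearZ.
by apply/fg; exists x.
Qed.

Lemma kills_above_leq a m n M : central a -> (m <= n)%N -> kills_above a m M -> kills_above a n M.
Proof.
move=> ac /subnK <-; elim: (n - m)%N => // k IH /IH; exact: kills_above_weaken.
Qed.

(** A lifting problem along [h] reduces to one along the identity of [M] by pulling [g] back along
    [h]; the fibre product is the kernel of [w]. *)
Lemma aprojectiveP a M : (forall X (g : {linear X -> M}), surjective g ->
  exists k : {linear M -> X}, forall x, g (k x) = a *: x) -> aprojective a M.
Proof.
move=> h0 X Y g h gs.
pose w := subL (compL g (fstL X M)) (compL h (sndL X M)).
have wE x : w x = g x.1 - h x.2 by rewrite !linE.
have [|k hk] := h0 _ (compL (sndL X M) (ker_inj w)).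
  move=> m; have [x hx] := gs (h m).
  have [|u hu] := @submod_ex _ _ _ (ker_submodule w) (x, m).
    by rewrite /kerset /= wE hx subrr.
  by exists u; rewrite !linE ker_injE hu.
exists (compL (fstL X M) (compL (ker_inj w) k)) => x.
have := submodP (k x); rewrite /kerset /= wE => /eqP; rewrite subr_eq0 => /eqP e.
by rewrite !linE ker_injE e -linearZ -hk !linE ker_injE.
Qed.

(** For n = 0, multiplication by [b] is lifted over [Z], the error lies in [Y], and there
    multiplication by [a] lifts; hence the product. The general case follows by the horseshoe lemma,
    which makes syzygies of [M] extensions of syzygies of [Z] by syzygies of [Y]. *)
Lemma kills_above_ext a b n Y M Z : central a -> central b -> short_exact Y M Z ->
  kills_above a n Y -> kills_above b n Z -> kills_above (a * b) n M.
Proof.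
move=> ac bc; elim: n => [|n IH] in Y M Z *.
  move=> [f [p [fI fp ps]]] Ya Zb; apply: aprojectiveP => X g gs.
  have [k hk] := Ya _ _ g f gs.
  have [|u hu] := Zb _ _ (compL p g) (idL Z).
    by move=> z; have [m <-] := ps z; have [x <-] := gs m; exists x; rewrite !linE.
  have {}hu z : p (g (u z)) = b *: z by have := hu z; rewrite !linE.
  (* The error of the lift over [Z]: b - g u p vanishes in [Z], hence takes values in [Y]. *)
  have [|v hv] := @lift_inj A _ _ _ f (subL (scaleL bc M) (compL g (compL u p))) fI.
    by move=> x; apply/fp; rewrite !linE linearB linearZ hu; exact: subrr.
  exists (addL (compL k v) (compL (scaleL ac X) (compL u p))) => x.
  by rewrite !linE linearD hk hv !linE linearZ -scalerDr subrK scalerA.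
move=> [f [p [fI fp ps]]] Ya Zb.
pose qY := cover_map Y; pose qZ := cover_map Z.
have [l hl] := @cover_projective A Z _ _ p qZ ps.
(* The horseshoe cover of [M]; its kernel is an extension of [kermod qZ] by [kermod qY]. *)
pose w := addL (compL f (compL qY (fstL _ _))) (compL l (sndL (cover Y) (cover Z))).
have wE x : w x = f (qY x.1) + l x.2 by rewrite !linE.
have pf y : p (f y) = 0 by apply/fp; exists y.
have ws : surjective w.
  move=> m; have [z hz] := cover_map_surj (p m).
  have [|y hy] := (fp (m - l z)).1; first by rewrite linearB hl hz subrr.
  have [y' hy'] := cover_map_surj y.
  by exists (y', z); rewrite wE /= hy' hy subrK.
apply: kills_aboveS (projective_prod (@cover_projective A Y) (@cover_projective A Z))
  (ker_short_exact ws) _; first exact: centralM.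
apply: IH (Ya _ _ (@cover_projective A Y) (ker_short_exact (@cover_map_surj A Y)))
   (Zb _ _ (@cover_projective A Z) (ker_short_exact (@cover_map_surj A Z))).
have [|i hi] := @submod_lift _ _ _ (ker_submodule w) (kermod qY)
    (pairL (ker_inj qY) (zeroL _ (cover Z))).
  by move=> x; rewrite /kerset /= wE !linE ker_injE /= (submodP x) !linear0 addr0.
have [|j hj] := @submod_lift _ _ _ (ker_submodule qZ) (kermod w)
    (compL (sndL _ (cover Z)) (ker_inj w)).
  move=> x; have := submodP x; rewrite /kerset /= wE => /(congr1 p).
  by rewrite linearD hl linear0 pf add0r !linE ker_injE.
have {}hi x : val (i x) = (val x, 0) by rewrite hi !linE ker_injE.
have {}hj x : val (j x) = (val x).2 by rewrite hj !linE ker_injE.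
exists i, j; split.
- by move=> x y e; apply: val_inj; have := congr1 val e; rewrite !hi => -[].
- move=> x; split=> [jx|[y <-]]; last by apply: val_inj; rewrite hj hi.
  have x2 : (val x).2 = 0 by rewrite -hj jx.
  have := submodP x; rewrite /kerset /= wE x2 linear0 addr0 => fx.
  have [|y hy] := @submod_ex _ _ _ (ker_submodule qY) (val x).1.
    by apply: fI; rewrite fx linear0.
  by exists y; apply: val_inj; rewrite hi hy; case: (val x) x2 => /= ? ? ->.
- move=> z; have [|y hy] := (fp (l (val z))).1; first by rewrite hl (submodP z).
  have [y' hy'] := cover_map_surj (- y).
  have [|x hx] := @submod_ex _ _ _ (ker_submodule w) (y', val z).
    by rewrite /kerset /= wE /= hy' linearN hy addNr.
  by exists x; apply: val_inj; rewrite hj hx.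
Qed.

End Epd.

(** * Comparison with projective resolutions *)

Section Resolutions.
Variable A : pzRingType.
Implicit Types (a b : A) (H K L M N P X Y Z : lmodType A).

Lemma exact_at0 K P M (f : {linear K -> P}) (g : {linear P -> M}) :
  exact_at f g -> forall x, g (f x) = 0.
Proof. by move=> fg x; apply/fg; exists x. Qed.

Section Tail.
Variables (M : lmodType A) (P : proj_resolution M).

Lemma tail_aug_ex : exists q : {linear res_mod P 1 -> kermod (res_aug P)},
  forall x, val (q x) = res_diff P 0 x.
Proof. by apply: submod_lift => x; exact: exact_at0 (@res_exact0 _ _ P) x. Qed.

Definition tail_aug := projT1 (cid tail_aug_ex).

Lemma tail_augE x : val (tail_aug x) = res_diff P 0 x.
Proof. by rewrite /tail_aug; case: cid. Qed.

Lemma tail_aug_surj : surjective tail_aug.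
Proof.
move=> y; have /(@res_exact0 _ _ P)[x hx] := submodP y.
by exists x; apply: val_inj; rewrite tail_augE.
Qed.

Lemma tail_exact0 : exact_at (res_diff P 1) tail_aug.
Proof.
move=> x; rewrite -(@res_exact _ _ P 0 x) -tail_augE.
by split=> [->//|h]; exact: val_inj.
Qed.

(** The shift of degrees is definitional: cocycles of [P] in degree i.+1 are cocycles of [tail P] in
    degree i, and for positive i the coboundaries agree too. Dimension shifting then needs no
    transport; [cons_res] shifts the other way. *)
Definition tail : proj_resolution (kermod (res_aug P)) :=
  @ProjResolution A _ (fun i => res_mod P i.+1) (fun i => res_diff P i.+1) tail_aug
    (fun i => @res_projective _ _ P i.+1) tail_aug_surj tail_exact0
    (fun i => @res_exact _ _ P i.+1).

End Tail.

Section Cons.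
Variables (K P M : lmodType A) (f : {linear K -> P}) (g : {linear P -> M}).
Hypotheses (Pp : projective P) (fI : injective f) (fg : exact_at f g) (gs : surjective g).
Variable Q : proj_resolution K.

Definition cons_mod i : lmodType A := if i is j.+1 then res_mod Q j else P.

Definition cons_diff i : {linear cons_mod i.+1 -> cons_mod i} :=
  match i with
  | 0 => compL f (res_aug Q)
  | j.+1 => res_diff Q j
  end.

Lemma cons_projective i : projective (cons_mod i).
Proof. by case: i => // i; exact: res_projective. Qed.

Lemma cons_exact0 : exact_at (cons_diff 0) g.
Proof.
move=> x; rewrite (fg x); split=> -[y <-] /=.
  by have [z <-] := @res_surj _ _ Q y; exists z; rewrite !linE.
by exists (res_aug Q y); rewrite !linE.
Qed.

Lemma cons_exact i : exact_at (cons_diff i.+1) (cons_diff i).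
Proof.
case: i => [|i] x /=; last exact: res_exact.
rewrite -(@res_exact0 _ _ Q x) !linE; split=> [h|->]; last exact: linear0.
by apply: fI; rewrite h linear0.
Qed.

Definition cons_res : proj_resolution M :=
  ProjResolution cons_projective gs cons_exact0 cons_exact.

End Cons.

Fixpoint cover_syz M n : lmodType A :=
  if n is n'.+1 then kermod (cover_map (cover_syz M n')) else M.

Definition cover_res M : proj_resolution M.
Proof.
pose d i : {linear cover (cover_syz M i.+1) -> cover (cover_syz M i)} :=
  compL (ker_inj _) (cover_map (cover_syz M i.+1)).
have dE i : exact_at (d i) (cover_map (cover_syz M i)).
  move=> x; rewrite (@ker_exact_at _ _ _ (cover_map (cover_syz M i)) x).
  split=> -[y <-]; last by exists (cover_map _ y); rewrite /d !linE.
  by have [z <-] := cover_map_surj y; exists z; rewrite /d !linE.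
refine (@ProjResolution A M (fun i => cover (cover_syz M i)) d (cover_map M) _ _ _ _).
- by move=> i; exact: cover_projective.
- exact: cover_map_surj.
- exact: (dE 0).
- move=> i x; rewrite -(dE i.+1 x) /d !linE; split=> [h|->]; last exact: linear0.
  by apply: ker_inj_inj; rewrite h linear0.
Defined.

(** In degree 1, a cocycle is a map [v] on the first syzygy. If [k] lifts multiplication by [a]
    through the augmentation, then a - k aug maps [res_mod P 0] into the syzygy and is
    multiplication by [a] there, so [a] times the cocycle extends to [res_mod P 0]. Higher degrees
    shift down along [tail]. *)
Lemma kills_Ext_kills_above a j M N : central a -> kills_above a j M -> kills_Ext a j.+1 M N.
Proof.
move=> ac; elim: j => [|j IH] in M *; last first.
  move=> Mj P f fc.
  have e := ker_short_exact (@res_surj _ _ P).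
  exact: (IH _ (Mj _ _ (@res_projective _ _ P 0) e) (tail P) f fc).
move=> Mp P f fc /=.
have [k hk] := Mp _ _ (res_aug P) (idL M) (@res_surj _ _ P).
have [|r hr] := @submod_lift A _ _ (ker_submodule (res_aug P)) _
    (subL (scaleL ac (res_mod P 0)) (compL k (res_aug P))).
  by move=> x; rewrite /kerset /= !linE linearB linearZ hk !linE; exact: subrr.
have [|v hv] := @descend A _ _ _ (tail_aug P) f (@tail_aug_surj _ P).
  by move=> x /(@tail_exact0 _ P)[y <-]; exact: fc.
exists (compL v r) => x; rewrite !linE -linearZ -hv; congr (v _).
apply: val_inj; rewrite hr tail_augE !linE.
by rewrite (exact_at0 (@res_exact0 _ _ P)) linear0 subr0 linearZ.
Qed.

Lemma syzygyS n M K : syzygy n.+1 M K -> exists2 L : lmodType A, syzygy1 M L & syzygy n L K.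
Proof.
elim: n => [|n IH] in K *.
  move=> [L ML [P [Pf Pp e]]]; exists K; last exact: isomorphic_refl.
  by exists P; split=> //; exact: short_exact_isor (isomorphic_sym ML) e.
by move=> [L /IH[L' ML' LL'] LK]; exists L' => //; exists L.
Qed.

Lemma syzygySI n M L K : syzygy1 M L -> syzygy n L K -> syzygy n.+1 M K.
Proof.
elim: n => [|n IH] in K *.
  move=> [P [Pf Pp e]] LK; exists M; first exact: isomorphic_refl.
  by exists P; split=> //; exact: short_exact_isol LK e.
by move=> ML [N LN NK]; exists N => //; exact: IH.
Qed.

(** The class of the syzygy sequence is universal. For j = 0 its annihilation extends multiplication
    by [a] on the syzygy to a map [g] on [P]. If [l] lifts [h v] to [X], then a l - l u g vanishes
    on the syzygy and descends to a lift of [a *: h]. For larger j, [H] stays fixed while [M] is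
    replaced by its syzygy. *)
Lemma kills_above_of_kills_Ext a j M H : central a -> syzygy j.+1 M H ->
  kills_Ext a j.+1 M H -> kills_above a j M.
Proof.
move=> ac; elim: j => [|j IH] in M *; last first.
  move=> /syzygyS[L [P [Pf Pp e]] LH] MH; apply: (kills_aboveS ac Pp e).
  apply: IH => // Q f fc; case: e => [u [v [uI uv vs]]].
  exact: (MH (cons_res Pp uI uv vs Q) f fc).
move=> [L ML [P [Pf Pp e]]] MH.
have {}ML := isomorphic_sym ML; have {ML}e := short_exact_isor ML e.
case: e => [u [v [uI uv vs]]].
(* The universal cocycle: the augmentation of a resolution of [H], seen in degree 1 of the
   resolution of [M] spliced from it. *)
have [|g hg] := MH (cons_res Pp uI uv vs (cover_res H)) (res_aug (cover_res H)).
  move=> x; exact: (exact_at0 (@res_exact0 _ _ (cover_res H)) x).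
have {}hg y : g (u y) = a *: y.
  have [z <-] := @res_surj _ _ (cover_res H) y.
  by rewrite hg /= linE.
move=> X Y q h qs.
have [l hl] := Pp _ _ q (compL h v) qs.
have [|k hk] := @descend A _ _ _ v (subL (compL (scaleL ac X) l) (compL l (compL u g))) vs.
  by move=> x /uv[y <-]; rewrite !linE hg !linearZ_LR -scalerDr; rewrite [_ + _]subrr scaler0.
exists k => x; have [y <-] := vs x; rewrite hk !linE linearB linearZ /= !hl !linE.
by rewrite (exact_at0 uv) linear0 subr0.
Qed.

Lemma pdim_le_kills_above M n : pdim_le M n -> kills_above 1 n M.
Proof.
elim: n => [|n IH] in M *; move=> [P hP]; last first.
  apply: kills_aboveS (@central1 A) (@res_projective _ _ P 0) (ker_short_exact (@res_surj _ _ P)) _.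
  by apply: IH; exists (tail P) => i ni; exact: hP.
apply: kills_above_iso (projective_kills_above 0 (@central1 A) (@res_projective _ _ P 0)).
have augI : injective (res_aug P).
  move=> x y /eqP; rewrite -subr_eq0 -linearB => /eqP /(@res_exact0 _ _ P)[z hz].
  by apply/eqP; rewrite -subr_eq0 -hz (hP 1%N _ z) // linear0.
have [|g hg] := @lift_inj A _ _ _ (res_aug P) (idL M) augI.
  by move=> x; have [y hy] := @res_surj _ _ P x; exists y; rewrite linE.
apply: (@isomorphic_intro _ _ _ (res_aug P) g) => x; last by rewrite hg linE.
by apply: augI; rewrite hg linE.
Qed.

Lemma kills_above_pdim_le M n : kills_above 1 n M -> pdim_le M n.
Proof.
elim: n => [|n IH] in M *; move=> hM; last first.
  have [P hP] := IH _ (hM _ _ (@cover_projective A M) (ker_short_exact (@cover_map_surj A M))).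
  exists (cons_res (@cover_projective A M) (@ker_inj_inj _ _ _ _) (@ker_exact_at _ _ _ _)
    (@cover_map_surj A M) P) => -[//|i] ni.
  exact: hP.
pose Z : lmodType A := 'rV[A]_0.
have Z0 := @zero_module_rV0 A.
have Zp : projective Z by exact/aprojective1/zero_aprojective.
have ZE X (f : {linear Z -> Z}) (g : {linear Z -> X}) : exact_at f g.
  by move=> x; rewrite (Z0 x) linear0; split=> // _; exists 0; exact: Z0.
pose Q : proj_resolution Z := @ProjResolution A Z (fun _ => Z) (fun _ => zeroL Z Z)
  (idL Z) (fun _ => Zp) (fun y => ex_intro _ y (idLE y)) (ZE _ _ _) (fun _ => ZE _ _ _).
have fI : injective (zeroL Z M) by move=> x y _; rewrite (Z0 x) (Z0 y).
have e : exact_at (zeroL Z M) (idL M).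
  move=> x; rewrite linE; split=> [->|[y <-]]; last by rewrite linE.
  by exists 0; rewrite linE.
have gs : surjective (idL M) by move=> x; exists x; rewrite linE.
by exists (cons_res (aprojective1 hM) fI e gs Q) => -[//|i] _; exact: Z0.
Qed.

End Resolutions.

(** * Finitely generated modules over noetherian rings *)

Section Generation.
Variable A : pzRingType.
Implicit Types (a : A) (G H K L M N P X Y Z : lmodType A).

Lemma centralX a n : central a -> central (a ^+ n).
Proof.
move=> ac; elim: n => [|n IH]; first by rewrite expr0; exact: central1.
by rewrite exprS; exact: centralM.
Qed.

Lemma zero_kills_above a n M : central a -> zero_module M -> kills_above a n M.
Proof.
by move=> ac M0; apply: projective_kills_above => //; exact/aprojective1/zero_aprojective.
Qed.

Lemma dsum_kills_above a n k (Y : nat -> lmodType A) : central a ->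
  (forall i, (i < k)%N -> kills_above a n (Y i)) -> kills_above a n (dsum k Y).
Proof.
move=> ac; elim: k => [|k IH] hY /=; first exact/zero_kills_above/zero_module_rV0.
by apply: kills_above_prod => //; [apply: IH => i ik; apply/hY/ltnW|exact: hY].
Qed.

Lemma retract_fst M N : retract M (M * N)%type.
Proof. by exists (pairL (idL M) (zeroL M N)), (fstL M N) => x; rewrite !linE. Qed.

Lemma add_closure_kills_above a n (X : subcat A) : central a ->
  subcat_sub X (kills_above a n) -> subcat_sub (add_closure X) (kills_above a n).
Proof.
move=> ac hX M [k [Y [W [hY MW]]]]; apply: kills_above_retract (retract_fst M W) _.
apply: kills_above_iso (isomorphic_sym MW) _.
by apply: dsum_kills_above => // i /hY /hX.
Qed.

(** Each extension step costs one factor [a], and [M] is a summand of the middle term. For k = 0 the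
    factor is 1 and the module is zero. *)
Lemma generated_kills_above a n (X : subcat A) k : central a ->
  subcat_sub X (kills_above a n) -> subcat_sub (generated X k) (kills_above (a ^+ k) n).
Proof.
move=> ac hX; have hadd := add_closure_kills_above ac hX.
elim: k => [|[|k] IH] M.
- by move=> M0; apply: zero_kills_above => //; exact: centralX.
- by move=> /hadd; rewrite expr1.
- move=> [Mf [W [Y [Z [Wf hY hZ e]]]]]; apply: kills_above_retract (retract_fst M W) _.
  rewrite exprSr; apply: kills_above_ext e _ _ => //; first exact: centralX.
  + exact: IH.
  + exact: hadd.
Qed.

Lemma syzygy_kills_above a n i G K : central a -> kills_above a n G ->
  syzygy i G K -> kills_above a n K.
Proof.
move=> ac; elim: i => [|i IH] in K *; first by move=> Ga /kills_above_iso; apply.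
move=> Ga [L GL [P [Pf Pp e]]].
exact: (kills_above_weaken ac (IH _ Ga GL)) Pp e.
Qed.

Lemma kills_above_syzygy a n i G K : central a -> syzygy i G K ->
  kills_above a n K -> kills_above a (i + n) G.
Proof.
move=> ac; elim: i => [|i IH] in n K *.
  by move=> /isomorphic_sym /kills_above_iso; apply.
move=> [L GL [P [Pf Pp e]]] Kn; rewrite addSnnS; apply: IH GL _.
exact: kills_aboveS ac Pp e Kn.
Qed.

Lemma syzygies_of_kills_above a n G : central a -> kills_above a n G ->
  subcat_sub (syzygies_of G) (kills_above a n).
Proof.
move=> ac Ga K [[i GK]|[_ Kp]]; first exact: syzygy_kills_above GK.
exact: projective_kills_above.
Qed.

Section Row.
Variables (b : nat) (M : lmodType A) (g : 'I_b -> M).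
Lemma row_linear : linear (fun v : 'rV[A]_b => \sum_i v 0 i *: g i).
Proof.
move=> c u v; rewrite scaler_sumr -big_split/=; apply: eq_bigr => i _.
by rewrite !mxE scalerDl scalerA.
Qed.
Definition rowL : {linear 'rV[A]_b -> M} := mk_linear row_linear.
Lemma rowLE v : rowL v = \sum_i v 0 i *: g i. Proof. exact: mk_linearE. Qed.
End Row.

Lemma linear_row b M (h : {linear 'rV[A]_b -> M}) v :
  h v = \sum_i v 0 i *: h (delta_mx 0 i).
Proof.
by rewrite {1}(row_sum_delta v) linear_sum; apply: eq_bigr => i _; rewrite linearZ.
Qed.

Lemma row_projective b : projective 'rV[A]_b.
Proof.
move=> X Y g h gs.
have /choice[k hk] : forall i, exists x, g x = h (delta_mx 0 i) by move=> i; exact: gs.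
exists (rowL k) => v; rewrite rowLE linear_sum [RHS]linear_row.
by apply: eq_bigr => i _; rewrite linearZ hk.
Qed.

Lemma row_fin_gen b : fin_gen 'rV[A]_b.
Proof.
exists b, (fun i => delta_mx 0 i); split=> // x _.
by exists (fun i => x 0 i); exact: row_sum_delta.
Qed.

Lemma fin_gen_row M : fin_gen M -> exists b (g : {linear 'rV[A]_b -> M}), surjective g.
Proof.
move=> [b [g [_ hg]]]; exists b, (rowL g) => x; have [//|c ->] := hg x.
by exists (\row_i c i); rewrite rowLE; apply: eq_bigr => i _; rewrite mxE.
Qed.

Lemma fg_set_submod M (S : set M) (hS : is_submodule S) : fg_set S -> fin_gen (submod hS).
Proof.
move=> [n [g [gS hg]]].
have /choice[u hu] : forall i, exists u : submod hS, val u = g i.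
  by move=> i; exact: submod_ex.
exists n, u; split=> // x _; have [c hc] := hg _ (submodP x).
exists c; apply: val_inj; rewrite hc -submodE linear_sum.
by apply: eq_bigr => i _; rewrite linearZ /= submodE hu.
Qed.

Hypothesis noeth : noetherian_module A^o.

(** Induction on the number k of coordinates that may be nonzero on [S]. The last of them maps [S]
    onto a left ideal [T], finitely generated by [noeth], and the kernel has one coordinate
    fewer. *)
Lemma row_noetherian b : noetherian_module 'rV[A]_b.
Proof.
suff: forall k (S : set 'rV[A]_b), is_submodule S ->
    (forall v, S v -> forall i : 'I_b, (k <= i)%N -> v 0 i = 0) -> fg_set S.
  move=> h S hS; apply: (h b) => // v _ i; by rewrite leqNgt ltn_ord.
elim=> [|k IH] S hS hk.
  exists 0%N, (fun i => 0); split=> [[]//|x Sx]; exists (fun i => 0).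
  by rewrite big_ord0; apply/rowP=> i; rewrite mxE hk.
have [bk|kb] := leqP b k.
  apply: IH => // v Sv i ki; have := ltn_ord i.
  by rewrite ltnNge (leq_trans bk ki).
have [S0 SN SD SB SZ] := is_submoduleP hS.
pose i0 := Ordinal kb; pose T : set A^o := [set c | exists2 v, S v & v 0 i0 = c].
have hT : is_submodule T.
  split=> [|x y [u Su <-] [v Sv <-]|c x [u Su <-]].
  - by exists 0 => //; rewrite mxE.
  - by exists (u + v); [exact: SD|rewrite mxE].
  - by exists (c *: u); [exact: SZ|rewrite mxE].
have [n [t [tT ht]]] := noeth hT.
have /choice[v hv] : forall i, exists v, S v /\ v 0 i0 = t i.
  by move=> i; have [v Sv e] := tT i; exists v.
have [||m [z [zS hz]]] := IH [set x | S x /\ x 0 i0 = 0].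
- split=> [|x y [Sx x0] [Sy y0]|c x [Sx x0]].
  + by rewrite /= mxE.
  + by split; [exact: SD|rewrite mxE x0 y0 addr0].
  + by split; [exact: SZ|rewrite mxE x0 mulr0].
- move=> x [Sx x0] i; rewrite leq_eqVlt => /orP[/eqP e|]; last exact: hk.
  by rewrite -[RHS]x0; congr (x 0 _); exact: val_inj.
exists (n + m)%N, (fun i : 'I_(n + m) =>
  match fintype.split i with inl j => v j | inr j => z j end); split.
  by move=> i; case: (fintype.split i) => j; [case: (hv j)|case: (zS j)].
move=> x Sx; have [|c hc] := ht (x 0 i0); first by exists x.
have [|c' hc'] := hz (x - \sum_i c i *: v i).
  split; first by apply: SB => //; apply: is_submodule_sum => // i; apply: SZ; case: (hv i).
  rewrite !mxE summxE hc; apply/eqP; rewrite subr_eq0; apply/eqP.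
  by apply: eq_bigr => i _; rewrite mxE (hv i).2.
exists (fun i : 'I_(n + m) => match fintype.split i with inl j => c j | inr j => c' j end).
rewrite big_split_ord /=.
under eq_bigr => i _ do rewrite (unsplitK (inl _ i)).
under [X in _ + X]eq_bigr => i _ do rewrite (unsplitK (inr _ i)).
by rewrite -hc' addrC subrK.
Qed.

Lemma fin_gen_cover M : fin_gen M -> exists b (g : {linear 'rV[A]_b -> M}),
  surjective g /\ fin_gen (kermod g).
Proof.
move=> /fin_gen_row[b [g gs]]; exists b, g; split=> //.
exact/fg_set_submod/row_noetherian/ker_submodule.
Qed.

Lemma fin_gen_syzygy n M : fin_gen M -> exists H : lmodType A, fin_gen H /\ syzygy n M H.
Proof.
elim: n => [|n IH] in M *; first by move=> Mf; exists M; split=> //; exact: isomorphic_refl.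
move=> /fin_gen_cover[b [g [gs /IH[H [Hf KH]]]]]; exists H; split=> //.
apply: syzygySI KH; exists ('rV[A]_b : lmodType A).
by split; [exact: row_fin_gen|exact: row_projective|exact: ker_short_exact].
Qed.

End Generation.

(** * Auslander's theorem on cyclic modules *)

Section Auslander.
Variable A : pzRingType.
Implicit Types (C E M N P X Y : lmodType A).

Definition linear_on M N (S : set M) (f : M -> N) :=
  forall (a : A) x y, S x -> S y -> f (a *: x + y) = a *: f x + f y.

(* C is isomorphic to S'' / S'. *)
Definition subquotient M (S' S'' : set M) C := exists q : M -> C,
  [/\ linear_on S'' q, forall c, exists2 x, S'' x & q x = c
    & forall x, S'' x -> (q x = 0 <-> S' x)].

Lemma linear_on0 M N (S : set M) (f : M -> N) : S 0 -> linear_on S f -> f 0 = 0.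
Proof.
move=> S0 fL; have := fL (-1) 0 0 S0 S0.
by rewrite scaler0 addr0 scaleN1r addNr.
Qed.

Lemma linear_onB M N (S : set M) (f : M -> N) x y : linear_on S f -> S x -> S y ->
  f (x - y) = f x - f y.
Proof.
by move=> fL Sx Sy; rewrite addrC -scaleN1r fL // scaleN1r addrC.
Qed.

Lemma linear_on_eval M N (S : set M) (f : M -> N) (phi : cover M) : is_submodule S ->
  linear_on S f -> (forall x, ~ S x -> coef phi x = 0) ->
  S (eval id phi) /\ f (eval id phi) = eval f phi.
Proof.
move=> hS fL hphi; have [S0 SN SD SB SZ] := is_submoduleP hS.
rewrite /eval; elim: (supp phi) => [|x s [IH1 IH2]].
  by rewrite !big_nil; split=> //; exact: linear_on0 fL.
rewrite !big_cons; have [Sx|/hphi ->] := pselect (S x); last by rewrite !scale0r !add0r.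
by split; [apply: SD => //; exact: SZ|rewrite fL // IH2].
Qed.

(* The first syzygy of S, realized inside [cover M]. It is monotone in S,     *)
(* commutes with unions of chains, and kappa S'' / kappa S' is a syzygy of    *)
(* S'' / S'; this makes Zorn's lemma on submodules of M available for lifts   *)
(* defined on higher syzygies.                                                *)
Definition kappa M (S : set M) : set (cover M) :=
  [set phi | (forall x, ~ S x -> coef phi x = 0) /\ eval id phi = 0].

Lemma kappa_submodule M (S : set M) : is_submodule (kappa S).
Proof.
split=> [|x y [x0 xe] [y0 ye]|a x [x0 xe]].
- by split=> //; rewrite -cover_mapE linear0.
- split=> [z /[dup]/x0 hx /y0 hy|]; first by rewrite coefD hx hy addr0.
  by move: xe ye; rewrite -!cover_mapE linearD => -> ->; rewrite addr0.
- split=> [z /x0 hx|]; first by rewrite coefZ hx mulr0.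
  by move: xe; rewrite -!cover_mapE linearZ => ->; exact: scaler0.
Qed.

(** Elements of S' vanish in [C], so the free module [P] on D = S'' \ S' already covers [C].
    Dropping the coefficients outside [D] maps kappa S'' onto the kernel of P -> C, and what it
    sends to 0 is supported on S', that is, lies in kappa S'. *)
Lemma subquotient_kappa M (S' S'' : set M) C :
  is_submodule S' -> is_submodule S'' -> S' `<=` S'' -> subquotient S' S'' C ->
  exists C' P : lmodType A,
    [/\ projective P, short_exact C' P C & subquotient (kappa S') (kappa S'') C'].
Proof.
move=> hS' hS'' sS [q [qL qs qk]].
have [S'0 _ _ _ _] := is_submoduleP hS'.
have [S0 SN SD SB SZ] := is_submoduleP hS''.
pose D : set M := [set x | S'' x /\ ~ S' x].
pose FD : set (cover M) := [set phi | forall x, ~ D x -> coef phi x = 0].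
have hFD : is_submodule FD.
  split=> [//|x y hx hy z hz|a x hx z hz].
    by rewrite coefD hx // hy // addr0.
  by rewrite coefZ hx // mulr0.
pose P : lmodType A := submod hFD.
have /choice[r0 hr0] : forall phi : cover M, exists p : P,
    forall x, coef (val p) x = if `[< D x >] then coef phi x else 0.
  move=> phi; have [||psi hpsi] := @cover_ex _ M (fun x => if `[< D x >] then coef phi x else 0).
  - by rewrite coef_at0 if_same.
  - by exists (supp phi) => x xs; rewrite suppP // if_same.
  have [|p hp] := @submod_ex _ _ _ hFD psi.
    by move=> x nD; rewrite hpsi; case: asboolP.
  by exists p => x; rewrite hp hpsi.
have r0L : linear r0.
  move=> a x y; apply/val_inj/coef_inj => z; rewrite linearP coefD coefZ !hr0 coefD coefZ.
  by case: asboolP; rewrite ?mulr0 ?addr0.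
pose r : {linear cover M -> P} := mk_linear r0L.
have rE phi x : coef (val (r phi)) x = if `[< D x >] then coef phi x else 0.
  by rewrite /r mk_linearE hr0.
have Pp : projective P.
  apply/aprojective1/(@aprojective_retract _ _ _ (cover M)).
    exists (submod_inj hFD), r => p; apply/val_inj/coef_inj => x; rewrite rE submodE.
    by case: asboolP => // /(submodP p) ->.
  exact: projective_aprojective (@central1 A) (@cover_projective A M).
pose w : {linear P -> C} := compL (evalL q) (submod_inj hFD).
have wE p : w p = eval q (val p) by rewrite /w compLE evalLE submodE.
have ws : surjective w.
  move=> c; have [x S''x <-] := qs c.
  have [S'x|nS'x] := pselect (S' x).
    by exists 0; rewrite linear0; apply/esym/qk.
  have [|p hp] := @submod_ex _ _ _ hFD (delta x).
    move=> y nDy; rewrite coef_delta; case: eqP => //= yx.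
    by case: nDy; rewrite yx.
  exists p; rewrite wE hp eval_delta //; apply/eqP => x0.
  by apply: nS'x; rewrite x0.
exists (kermod w), P; split=> //; first exact: ker_short_exact.
have evE phi : (forall x, ~ S'' x -> coef phi x = 0) -> eval q (val (r phi)) = eval q phi.
  move=> hphi; rewrite (@evalE _ _ _ _ (val (r phi)) (supp phi)) ?supp_uniq //; last first.
    by move=> x xs; rewrite rE suppP // if_same.
  apply: eq_bigr => x _; rewrite rE; case: asboolP => // nD.
  have [S''x|/hphi ->] := pselect (S'' x); last by rewrite scale0r.
  suff -> : q x = 0 by rewrite !scaler0.
  by apply/qk => //; apply: contrapT => nS'; apply: nD.
have /choice[q' hq'] : forall phi : cover M, exists c : kermod w, kappa S'' phi -> val c = r phi.
  move=> phi; have [[h1 h2]|] := pselect (kappa S'' phi); last by exists 0.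
  have [|c hc] := @submod_ex _ _ _ (ker_submodule w) (r phi).
    rewrite /kerset /= wE evE //; have [_ <-] := linear_on_eval hS'' qL h1.
    by rewrite h2; exact: linear_on0 qL.
  by exists c.
have [k0 kN kD kB kZ] := is_submoduleP (@kappa_submodule _ S'').
exists q'; split.
- move=> a x y hx hy; apply: (@ker_inj_inj _ _ _ w).
  rewrite linearP !ker_injE hq'; last by apply: kD => //; exact: kZ.
  by rewrite linearP !hq'.
- move=> c; have cD := submodP (val c); have cw := submodP c.
  have h1 x : ~ S'' x -> coef (val (val c)) x = 0 by move=> nS; apply: cD => -[].
  have [Ss e] := linear_on_eval hS'' qL h1.
  have S's : S' (eval id (val (val c))) by apply/qk => //; rewrite e -wE.
  (* A relation in [C] evaluates in [M] to an element of S', perhaps not to 0. Subtracting the basis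
     vector at that element makes the value 0, and [r] forgets this correction. *)
  have hk : kappa S'' (val (val c) - delta (eval id (val (val c)))).
    split=> [x nS|]; last by rewrite -cover_mapE linearB !cover_mapE eval_delta_id subrr.
    rewrite coefD coefN h1 // coef_delta; case: eqP => [xe|]; last by rewrite oppr0 addr0.
    by case: nS; rewrite xe.
  exists (val (val c) - delta (eval id (val (val c)))) => //.
  apply/val_inj/val_inj/coef_inj => x; rewrite hq' // rE.
  case: asboolP => [[S''x nS'x]|/cD -> //].
  rewrite coefD coefN coef_delta; case: eqP => [xe|]; last by rewrite oppr0 addr0.
  by case: nS'x; rewrite xe.
- move=> phi hk; split=> [e|[h1 h2]].
    have {}e : r phi = 0 by rewrite -hq' // e.
    case: hk => h1 h2; split=> // x nS'.
    have [S''x|/h1 //] := pselect (S'' x).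
    have := rE phi x; rewrite e; case: asboolP => [_ <- //|nD].
    by case: nD.
  apply: val_inj; rewrite hq' //; apply/val_inj/coef_inj => x; rewrite rE.
  by case: asboolP => // -[_ /h1].
Qed.

Fixpoint covers M n : lmodType A := if n is n'.+1 then cover (covers M n') else M.

Fixpoint kappas M n (S : set M) : set (covers M n) :=
  match n return set (covers M n) with 0 => S | n'.+1 => kappa (@kappas M n' S) end.
Arguments kappas {M} n S.

Lemma kappas_submodule M n (S : set M) : is_submodule S -> is_submodule (kappas n S).
Proof. by case: n => // n _; exact: kappa_submodule. Qed.

Lemma kappas_subset M n (S T : set M) : S `<=` T -> kappas n S `<=` kappas n T.
Proof.
move=> ST; elim: n => //= n IH phi [h1 h2]; split=> // x nT.
by apply: h1 => /IH.
Qed.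

(** [cover] has no basis vector at 0, so every iterated syzygy of the zero submodule vanishes. *)
Lemma kappas0 M n phi : kappas n [set (0 : M)] phi -> phi = 0.
Proof.
elim: n phi => //= n IH phi [h1 h2]; apply: coef_inj => x; rewrite coef0.
by have [/IH ->|/h1 //] := pselect (kappas n [set 0] x); exact: coef_at0.
Qed.

(** Supports are finite, so in a chain the finitely many memberships that put [phi] in the syzygy of
    the union hold in one member. *)
Lemma kappas_bigcup M n (F : set (set M)) : F !=set0 -> total_on F subset ->
  forall phi, kappas n (\bigcup_(S in F) S) phi -> exists2 S, F S & kappas n S phi.
Proof.
move=> [S0 FS0] Ftot; elim: n => [phi [S FS Sphi]|n IH phi /= [h1 h2]]; first by exists S.
suff [S FS hS] : exists2 S, F S &
    forall x, x \in supp phi -> kappas n (\bigcup_(S in F) S) x -> kappas n S x.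
  exists S => //; split=> // x nS.
  have [xs|/suppP //] := boolP (x \in supp phi).
  by apply: h1 => /(hS _ xs).
elim: (supp phi) => [|x s [S FS hS]]; first by exists S0.
have [/IH[T FT Tx]|nx] := pselect (kappas n (\bigcup_(S in F) S) x); last first.
  by exists S => // y; rewrite inE => /orP[/eqP -> //|]; exact: hS.
have [ST|TS] := Ftot _ _ FS FT.
  exists T => // y; rewrite inE => /orP[/eqP -> //|ys hy].
  exact: kappas_subset ST _ (hS _ ys hy).
exists S => // y; rewrite inE => /orP[/eqP -> _|]; last exact: hS.
exact: kappas_subset TS _ Tx.
Qed.

Lemma subquotient_kappas M n (S' S'' : set M) C :
  is_submodule S' -> is_submodule S'' -> S' `<=` S'' -> subquotient S' S'' C ->
  exists Cn : lmodType A, subquotient (kappas n S') (kappas n S'') Cn /\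
    forall m, kills_above 1 m Cn <-> kills_above 1 (n + m) C.
Proof.
move=> hS' hS'' sS hC; elim: n => [|n [Cn [hCn IH]]]; first by exists C; split=> // m; rewrite add0n.
have [C' [P [Pp e hC']]] := subquotient_kappa (kappas_submodule n hS')
  (kappas_submodule n hS'') (kappas_subset (n := n) sS) hCn.
exists C'; split=> // m; rewrite addSnnS -IH; split; last by move=> h; exact: h Pp e.
exact: kills_aboveS (@central1 A) Pp e.
Qed.

(** Projectivity of [C] splits [q] by [s]. Then y - s (q y) lies in S', where [k] is available, and
    s (q y) is lifted through [C]. *)
Lemma extend_lift E (S' S'' : set E) C X Y (g : {linear X -> Y}) (h : E -> Y) (k : E -> X) :
  is_submodule S' -> is_submodule S'' -> S' `<=` S'' -> subquotient S' S'' C ->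
  projective C -> surjective g -> linear_on S'' h -> linear_on S' k ->
  (forall y, S' y -> g (k y) = h y) ->
  exists k' : E -> X, [/\ linear_on S'' k', forall y, S'' y -> g (k' y) = h y
    & forall y, S' y -> k' y = k y].
Proof.
move=> hS' hS'' sS [q [qL qs qk]] Cp gs hL kL gk.
have [S0 SN SD SB SZ] := is_submoduleP hS''.
have q1L : linear (fun u : submod hS'' => q (val u)).
  by move=> a u v; rewrite linearP qL //; exact: submodP.
have h1L : linear (fun u : submod hS'' => h (val u)).
  by move=> a u v; rewrite linearP hL //; exact: submodP.
have [|s hs] := Cp _ _ (mk_linear q1L) (idL C).
  move=> c; have [x /(submod_ex hS'')[u <-] <-] := qs c.
  by exists u; rewrite mk_linearE.
have {}hs c : q (val (s c)) = c by have := hs c; rewrite mk_linearE linE.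
have [l hl] := Cp _ _ g (compL (mk_linear h1L) s) gs.
have {}hl c : g (l c) = h (val (s c)) by rewrite hl compLE mk_linearE.
have Ss c : S'' (val (s c)) by exact: submodP.
have S's y : S'' y -> S' (y - val (s (q y))).
  by move=> Sy; apply/qk; [exact: SB|rewrite (linear_onB qL) // hs subrr].
exists (fun y => k (y - val (s (q y))) + l (q y)); split.
- move=> a x y Sx Sy.
  have -> : a *: x + y - val (s (q (a *: x + y)))
      = a *: (x - val (s (q x))) + (y - val (s (q y))).
    by rewrite qL // linearP -!submodE linearP opprD scalerBr addrACA.
  by rewrite kL; [rewrite qL // linearP scalerDr addrACA|exact: S's..].
- by move=> y Sy; rewrite linearD gk ?hl; [rewrite (linear_onB hL) // subrK|exact: S's].
- move=> y S'y; have -> : q y = 0 by apply/qk => //; exact: sS.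
  by rewrite !linear0 !addr0.
Qed.

Definition add_line M (S : set M) (x : M) : set M :=
  [set y | exists a : A, S (y - a *: x)].

Lemma add_line_submodule M (S : set M) x : is_submodule S -> is_submodule (add_line S x).
Proof.
move=> hS; have [S0 SN SD SB SZ] := is_submoduleP hS.
split=> [|y z [a ya] [b zb]|c y [a ya]].
- by exists 0; rewrite scale0r subrr.
- by exists (a + b); rewrite scalerDl opprD addrACA; exact: SD.
- by exists (c * a); rewrite -scalerA -scalerBr; exact: SZ.
Qed.

Lemma subset_add_line M (S : set M) x : S `<=` add_line S x.
Proof. by move=> y Sy; exists 0; rewrite scale0r subr0. Qed.

Lemma colon_submodule M (S : set M) (x : M) : is_submodule S ->
  is_submodule ([set a | S (a *: x)] : set A^o).
Proof.
case=> S0 SD SZ; split=> [|a b ha hb|c a ha] /=; first by rewrite scale0r.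
  by rewrite scalerDl; exact: SD.
by rewrite -scalerA; exact: SZ.
Qed.

(** (S + A x) / S is cyclic, generated by the class of [x]; the map [q] reads off a chosen
    coefficient [c] of [x], well defined modulo the colon ideal. *)
Lemma add_line_subquotient M (S : set M) x (hS : is_submodule S) :
  subquotient S (add_line S x) (quot (colon_submodule x hS)).
Proof.
have [S0 SN SD SB SZ] := is_submoduleP hS.
have /choice[c hc] : forall y, exists a : A, add_line S x y -> S (y - a *: x).
  move=> y; have [[a ha]|] := pselect (add_line S x y); first by exists a.
  by exists 0.
have [_ _ LD _ LZ] := is_submoduleP (add_line_submodule x hS).
pose pi := quot_proj (colon_submodule x hS).
have piE (a b : A) : S (a *: x - b *: x) -> pi a = pi b.
  move=> h; apply/eqP; rewrite -subr_eq0 -linearB; apply/eqP/quot_proj_eq0.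
  by rewrite /= scalerBl.
exists (fun y => pi (c y)); split.
- move=> a y z hy hz; rewrite -linearP; apply: piE.
  have h := hc _ (LD _ _ (LZ a _ hy) hz).
  have h' := SD _ _ (SZ a _ (hc _ hy)) (hc _ hz).
  suff -> : c (a *: y + z) *: x - (a * c y + c z) *: x =
      a *: (y - c y *: x) + (z - c z *: x) - (a *: y + z - c (a *: y + z) *: x).
    exact: SB.
  rewrite scalerDl -scalerA scalerBr addrACA -opprD [- (_ + _ - _)]opprB.
  by rewrite [RHS]addrC addrA subrK.
- move=> u; have [a <-] := quot_proj_surj u; exists ((a : A) *: x).
    by exists a; rewrite subrr.
  apply: piE; have /hc h : add_line S x ((a : A) *: x) by exists a; rewrite subrr.
  by rewrite -opprB; exact: SN.
- move=> y hy; rewrite quot_proj_eq0 /=; split=> h.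
    by rewrite -(subrK (c y *: x) y); apply: SD => //; exact: hc.
  by rewrite -(subKr y (c y *: x)); apply: SB => //; exact: hc.
Qed.

(** The n-th syzygy of [M] is shown projective by Zorn's lemma, applied to lifts defined on the
    syzygies [kappas n S] of submodules [S]. Adjoining one element to [S] changes the syzygy by an
    n-th syzygy of a cyclic module, projective by hypothesis, so a lift always extends and a maximal
    one is defined everywhere. *)
Lemma auslander n : (forall (I : set A^o) (hI : is_submodule I), kills_above 1 n (quot hI)) ->
  forall M, kills_above 1 n M.
Proof.
move=> hcyc M.
have h0 : is_submodule [set (0 : M)].
  by split=> [//|x y -> ->|a x ->]; rewrite /= ?addr0 ?scaler0.
have hT : is_submodule [set: M] by [].
have MT : subquotient [set (0 : M)] [set: M] M by exists id; split=> // c; exists c.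
have [Cn [[q [qL qs qk]] hCn]] := subquotient_kappas n h0 hT (@subsetT _ _) MT.
rewrite -[n]addn0; apply/hCn => X Y g h gs.
pose E := covers M n.
(* Partial lifts are total functions constrained only on [kappas n p.1]. They may differ elsewhere,
   so [R] is a preorder only. *)
pose ok (p : set M * (E -> X)) := [/\ is_submodule p.1, linear_on (kappas n p.1) p.2
  & forall y, kappas n p.1 y -> g (p.2 y) = h (q y)].
pose T := {p | ok p}.
pose R (s t : T) := `[< (sval s).1 `<=` (sval t).1 /\
  forall y, kappas n (sval s).1 y -> (sval t).2 y = (sval s).2 y >].
have hqL : linear_on (kappas n setT) (fun y => h (q y)).
  by move=> a x y hx hy; rewrite qL // linearP.
have ok0 : ok ([set 0], fun=> 0).
  split=> [//|a x y|y /kappas0 ->]; first by rewrite scaler0 addr0.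
  by rewrite linear0 (linear_on0 _ hqL) //; case: (kappas_submodule n hT).
have Rxx t : R t t by apply/asboolP; split.
have Rtr r s t : R r s -> R s t -> R r t.
  move=> /asboolP[rs1 rs2] /asboolP[st1 st2]; apply/asboolP; split; first exact: subset_trans st1.
  by move=> y hy; rewrite st2 ?rs2 //; exact: kappas_subset rs1 _ hy.
have [|t tmax] := ZL_preorder (exist _ _ ok0 : T) Rxx Rtr.
  move=> F Ftot; have [[t0 Ft0]|F0] := pselect (F !=set0); last first.
    by exists (exist _ _ ok0) => s Fs; case: F0; exists s.
  pose G := [set (sval t).1 | t in F].
  have G0 : G !=set0 by exists (sval t0).1, t0.
  have Gtot : total_on G subset.
    by move=> _ _ [s Fs <-] [t Ft <-]; have [/asboolP[]|/asboolP[]] := Ftot _ _ Fs Ft; [left|right].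
  pose U := \bigcup_(S in G) S.
  have /choice[k hk] : forall y : E, exists x, forall t, F t -> kappas n (sval t).1 y -> x = (sval t).2 y.
    move=> y; have [[t [Ft ht]]|nt] := pselect (exists t, F t /\ kappas n (sval t).1 y); last first.
      by exists 0 => t Ft ht; case: nt; exists t.
    exists ((sval t).2 y) => s Fs hs.
    by have [/asboolP[_ ->]|/asboolP[_ ->]] := Ftot _ _ Fs Ft.
  have in_chain y : kappas n U y -> exists2 t, F t & kappas n (sval t).1 y.
    by move=> /(kappas_bigcup G0 Gtot)[_ [t Ft <-] ht]; exists t.
  have Uok : ok (U, k).
    split=> /=.
    - split=> [|x y [_ [s Fs <-] sx] [_ [t Ft <-] ty]|a x [_ [s Fs <-] sx]].
      + by exists (sval t0).1; [exists t0|case: (svalP t0) => -[]].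
      + have [/asboolP[st _]|/asboolP[ts _]] := Ftot _ _ Fs Ft.
          exists (sval t).1; first by exists t.
          by case: (svalP t) => -[_ tD _] _ _; apply: tD => //; exact: st.
        exists (sval s).1; first by exists s.
        by case: (svalP s) => -[_ sD _] _ _; apply: sD => //; exact: ts.
      + exists (sval s).1; first by exists s.
        by case: (svalP s) => -[_ _ sZ] _ _; exact: sZ.
    - move=> a x y /in_chain[s Fs sx] /in_chain[t Ft ty].
      have [u [Fu ux uy]] : exists u, [/\ F u, kappas n (sval u).1 x & kappas n (sval u).1 y].
        have [/asboolP[st _]|/asboolP[ts _]] := Ftot _ _ Fs Ft.
          by exists t; split=> //; exact: kappas_subset st _ sx.
        by exists s; split=> //; exact: kappas_subset ts _ ty.
      have [us uL _] := svalP u; have [_ uD uZ] := kappas_submodule n us.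
      by rewrite !(hk _ u) // ?uL //; apply: uD => //; exact: uZ.
    - move=> y /in_chain[t Ft ty]; rewrite (hk _ t) //.
      by case: (svalP t) => _ _; apply.
  exists (exist _ _ Uok) => s Fs; apply/asboolP; split=> /=.
    by move=> x sx; exists (sval s).1 => //; exists s.
  by move=> y sy; exact: hk.
have [tS tL tg] := svalP t.
have tT : (sval t).1 = setT.
  apply/seteqP; split=> // x _.
  have hC := add_line_subquotient x tS.
  have hS'' := add_line_submodule x tS.
  have [Dn [hDn Dk]] := subquotient_kappas n tS hS'' (@subset_add_line _ _ x) hC.
  have Dp : projective Dn by apply/aprojective1; apply/(Dk 0%N); rewrite addn0; exact: hcyc.
  have hL'' : linear_on (kappas n (add_line (sval t).1 x)) (fun y => h (q y)).
    by move=> a y z hy hz; apply: hqL; [move: hy|move: hz]; exact/kappas_subset.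
  have [k' [k'L k'g k'k]] := extend_lift (kappas_submodule n tS) (kappas_submodule n hS'')
    (kappas_subset (n := n) (@subset_add_line _ _ x)) hDn Dp gs hL'' tL tg.
  have ok' : ok (add_line (sval t).1 x, k') by [].
  have /tmax /asboolP[+ _] : R t (exist _ _ ok') by apply/asboolP; split=> //; exact: subset_add_line.
  move=> /= sub; apply: sub; exists 1; rewrite scale1r subrr.
  by case: (tS).
rewrite tT in tL tg.
have [_ uD uZ] := kappas_submodule n hT.
(* [q] is injective on [kappas n setT], its kernel [kappas n [set 0]] being zero; hence the lift
   transports to [Cn] along the section [s]. *)
have /choice[s hs] : forall c, exists y, kappas n setT y /\ q y = c.
  by move=> c; have [y] := qs c; exists y.
have vL : linear (fun c => (sval t).2 (s c)).
  move=> a x y; rewrite -tL ?(hs _).1 //; try exact: (hs _).1.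
  congr (_ _); apply/eqP; rewrite -subr_eq0; apply/eqP/(@kappas0 M n).
  have h1 : kappas n setT (a *: s x + s y) by apply: uD; [apply: uZ|]; exact: (hs _).1.
  have [_ _ _ uB _] := is_submoduleP (kappas_submodule n hT).
  apply/qk; first by apply: uB => //; exact: (hs _).1.
  rewrite (linear_onB qL) //; last exact: (hs _).1.
  rewrite qL; [|exact: (hs _).1..].
  by rewrite !(hs _).2 subrr.
exists (mk_linear vL) => c; rewrite mk_linearE scale1r tg; last exact: (hs _).1.
by rewrite (hs c).2.
Qed.

End Auslander.

(** * Rings of fractions *)

(** Central localization by its properties, so that the arguments apply to the opposite rings over
    which right modules live. The left inverse in [denom_inv] is two-sided by
    [denom_central_image]. *)
Record ring_of_fractions (A B : pzRingType) (iota : {rmorphism A -> B}) (D : set A) : Prop :=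
  RingOfFractions {
    denom_one : D 1;
    denom_mul : forall s t, D s -> D t -> D (s * t);
    denom_central : forall s, D s -> central s;
    denom_central_image : forall s, D s -> central (iota s);
    denom_inv : forall s, D s -> exists t, t * iota s = 1;
    frac_ex : forall y, exists s x, D s /\ iota s * y = iota x;
    frac_ker : forall x, iota x = 0 -> exists2 s, D s & s * x = 0 }.

Section Fractions.
Variables (A B : pzRingType) (iota : {rmorphism A -> B}) (D : set A).
Hypothesis AB : ring_of_fractions iota D.
Implicit Types (K M N : lmodType A) (C E : lmodType B).

Let D1 := denom_one AB.
Let DM := denom_mul AB.
Let Dc := denom_central AB.
Let Dci := denom_central_image AB.

Definition semilinear M C (phi : M -> C) :=
  forall a x y, phi (a *: x + y) = iota a *: phi x + phi y.

Lemma semilinear0 M C (phi : M -> C) : semilinear phi -> phi 0 = 0.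
Proof.
move=> h; have := h 0 0 0; rewrite scaler0 addr0 rmorph0 scale0r add0r => e.
by have := h (-1) 0 0; rewrite scaler0 addr0 rmorphN1 scaleN1r addNr.
Qed.

Lemma semilinearZ M C (phi : M -> C) a x : semilinear phi -> phi (a *: x) = iota a *: phi x.
Proof. by move=> h; rewrite -[a *: x]addr0 h (semilinear0 h) addr0. Qed.

Lemma semilinearD M C (phi : M -> C) x y : semilinear phi -> phi (x + y) = phi x + phi y.
Proof. by move=> h; rewrite -{1}[x]scale1r h rmorph1 scale1r. Qed.

Lemma semilinearB M C (phi : M -> C) x y : semilinear phi -> phi (x - y) = phi x - phi y.
Proof.
by move=> h; rewrite semilinearD // -scaleN1r semilinearZ // rmorphN1 scaleN1r.
Qed.

Lemma semilinear_sum M C (phi : M -> C) n (c : 'I_n -> A) (w : 'I_n -> M) : semilinear phi ->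
  phi (\sum_i c i *: w i) = \sum_i iota (c i) *: phi (w i).
Proof.
move=> h; elim/big_rec2: _ => [|i y x _ <-]; first exact: semilinear0.
exact: h.
Qed.

(** This characterizes [C] as the localization of [M] at [D]: only torsion dies, and every element
    is a fraction. *)
Definition localizes M C (theta : M -> C) :=
  [/\ semilinear theta, forall x, theta x = 0 -> exists2 s, D s & s *: x = 0
    & forall c, exists s x, D s /\ iota s *: c = theta x].

Lemma denom_scale0 C s (c : C) : D s -> iota s *: c = 0 -> c = 0.
Proof.
move=> /(denom_inv AB)[t ts] /(congr1 (fun u => t *: u)).
by rewrite scalerA ts scale1r scaler0.
Qed.

Lemma denom_scale_inj C s (c c' : C) : D s -> iota s *: c = iota s *: c' -> c = c'.
Proof.
move=> Ds e; apply/eqP; rewrite -subr_eq0; apply/eqP/(denom_scale0 Ds).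
by rewrite scalerBr e subrr.
Qed.

Lemma denom_scaleA C s b (c : C) : D s -> iota s *: (b *: c) = b *: (iota s *: c).
Proof. by move=> Ds; rewrite !scalerA Dci. Qed.

Lemma localizes_eq M C (theta : M -> C) E (f g : {linear C -> E}) : localizes theta ->
  (forall x, f (theta x) = g (theta x)) -> forall c, f c = g c.
Proof.
move=> [_ _ hf] fg c; have [s [x [Ds e]]] := hf c.
by apply: (denom_scale_inj Ds); rewrite -!linearZ /= e.
Qed.

Lemma localizes_map M C (theta : M -> C) N E (theta' : N -> E) (f : {linear M -> N}) :
  localizes theta -> localizes theta' ->
  exists F : {linear C -> E}, forall x, F (theta x) = theta' (f x).
Proof.
move=> [tL tk tf] [tL' tk' tf'].
have key s x s' x' c : D s -> D s' -> iota s *: c = theta x -> iota s' *: c = theta x' ->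
    iota s' *: theta' (f x) = iota s *: theta' (f x').
  move=> Ds Ds' e e'.
  have [|u Du hu] := tk (s' *: x - s *: x').
    by rewrite semilinearB // !semilinearZ // -e -e' (denom_scaleA _ _ Ds) subrr.
  have e2 : theta' (f (s' *: x - s *: x')) = iota s' *: theta' (f x) - iota s *: theta' (f x').
    by rewrite linearB 2!linearZ_LR semilinearB // !semilinearZ.
  apply/eqP; rewrite -subr_eq0 -e2; apply/eqP/(denom_scale0 Du).
  by rewrite -semilinearZ // -linearZ_LR hu linear0 semilinear0.
have /choice[F hF] : forall c, exists e, forall s x, D s -> iota s *: c = theta x ->
    iota s *: e = theta' (f x).
  move=> c; have [s [x [Ds e]]] := tf c; have [t ts] := denom_inv AB Ds.
  exists (t *: theta' (f x)) => s' x' Ds' e'.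
  apply: (denom_scale_inj Ds); rewrite -(key _ _ _ _ _ Ds Ds' e e').
  by rewrite (denom_scaleA _ _ Ds') scalerA (Dci Ds) ts scale1r.
have FL : linear F.
  move=> b c c'; have [s1 [x1 [Ds1 e1]]] := tf c; have [s2 [x2 [Ds2 e2]]] := tf c'.
  have [s0 [a [Ds0 e0]]] := frac_ex AB b.
  have Ds : D (s0 * (s1 * s2)) by apply: DM => //; exact: DM.
  apply: (denom_scale_inj Ds).
  have E1 : iota (s0 * (s1 * s2)) * b = iota s2 * iota a * iota s1.
    rewrite -e0 -(Dci Ds1) !rmorphM -!mulrA (Dci Ds0) -!mulrA; congr (_ * (_ * _)).
    by rewrite (Dci Ds0).
  have E2 : iota (s0 * (s1 * s2)) = iota (s0 * s1) * iota s2 by rewrite mulrA rmorphM.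
  (* With b = a / s0, c = x1 / s1 and c' = x2 / s2, this is the numerator of b c + c' over s0 s1
     s2. *)
  rewrite (hF _ _ (s2 *: (a *: x1) + (s0 * s1) *: x2)) //; last first.
    rewrite scalerDr semilinearD // !semilinearZ // -e1 -e2.
    by rewrite scalerA E1 -!scalerA E2 -scalerA.
  rewrite linearD !linearZ_LR semilinearD // !semilinearZ // scalerDr; congr (_ + _).
    by rewrite -(hF _ _ _ Ds1 e1) [RHS]scalerA E1 -!scalerA.
  by rewrite -(hF _ _ _ Ds2 e2) scalerA E2.
by exists (mk_linear FL) => x; rewrite mk_linearE -[LHS]scale1r -(rmorph1 iota) (hF _ _ x) // rmorph1 scale1r.
Qed.

Lemma common_denom n (P : 'I_n -> A -> Prop) :
  (forall i s t, D t -> P i s -> P i (t * s)) -> (forall i, exists2 s, D s & P i s) ->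
  exists2 s, D s & forall i, P i s.
Proof.
move=> hP hex; suff [s Ds hs] : exists2 s, D s & forall i, i \in enum 'I_n -> P i s.
  by exists s => // i; apply: hs; rewrite mem_enum.
elim: (enum 'I_n) => [|i r [s Ds hs]]; first by exists 1.
have [t Dt ht] := hex i; exists (t * s); first exact: DM.
move=> j; rewrite inE => /orP[/eqP ->|/hs]; last exact: hP.
by rewrite (Dc Dt); exact: hP.
Qed.

Lemma semilinear_kills M N E (theta : N -> E) (f : {linear M -> N}) : localizes theta ->
  fin_gen M -> (forall x, theta (f x) = 0) -> exists2 s, D s & forall x, s *: f x = 0.
Proof.
move=> [tL tk tf] [n [g [_ hg]]] f0.
have [||s Ds hs] := @common_denom n (fun i s => s *: f (g i) = 0).
- by move=> i s t _ e; rewrite -scalerA e scaler0.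
- by move=> i; apply: tk.
exists s => // x; have [//|c ->] := hg x.
rewrite linear_sum scaler_sumr big1 // => i _.
by rewrite linearZ_LR scalerA Dc // -scalerA hs scaler0.
Qed.

Lemma denom_kills_above1 s n C : D s -> kills_above (iota s) n C -> kills_above 1 n C.
Proof.
move=> Ds; have [t ts] := denom_inv AB Ds; have sc := Dci Ds.
have st : iota s * t = 1 by rewrite sc.
have tc : central t.
  move=> b; rewrite -[LHS]mulr1 -st -!mulrA (mulrA b) -sc -!mulrA.
  by rewrite (mulrA t) ts mul1r.
elim: n => [|n IH] in C *; last by move=> h K P Pp e; apply: IH; exact: h Pp e.
move=> h X Y g f gs; have [k hk] := h _ _ g f gs.
exists (compL (scaleL tc X) k) => x.
by rewrite !linE linearZ_LR hk scalerA ts.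
Qed.

Definition row_map b : 'rV[A]_b -> 'rV[B]_b := map_mx iota.

Lemma row_map_localizes b : localizes (@row_map b : ('rV[A]_b : lmodType A) -> ('rV[B]_b : lmodType B)).
Proof.
split=> [a x y|x x0|c].
- by apply/rowP=> i; rewrite !mxE rmorphD rmorphM.
- have [||s Ds hs] := @common_denom b (fun i s => s * x 0 i = 0).
  + by move=> i s t _ e; rewrite -mulrA e mulr0.
  + move=> i; have /(frac_ker AB)[s Ds hs] : iota (x 0 i) = 0.
      by have /rowP/(_ i) := x0; rewrite !mxE.
    by exists s.
  by exists s => //; apply/rowP=> i; rewrite !mxE.
- have [||s Ds hs] := @common_denom b (fun i s => exists x, iota s * c 0 i = iota x).
  + by move=> i s t _ [x e]; exists (t * x); rewrite rmorphM -mulrA e rmorphM.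
  + by move=> i; have [s [x [Ds e]]] := frac_ex AB (c 0 i); exists s => //; exists x.
  have /choice[x hx] := hs; exists s, (\row_i x i); split=> //.
  by apply/rowP=> i; rewrite !mxE.
Qed.

Lemma localizes_surj M C (theta : M -> C) N E (nu : N -> E) (g : {linear N -> M})
    (F : {linear E -> C}) : localizes theta -> (forall x, F (nu x) = theta (g x)) ->
  surjective g -> surjective F.
Proof.
move=> [_ _ tf] hF gs c; have [s [x [Ds e]]] := tf c.
have [t ts] := denom_inv AB Ds; have [y hy] := gs x.
by exists (t *: nu y); rewrite linearZ_LR hF hy -e scalerA ts scale1r.
Qed.

Lemma localizes_ker M C (theta : M -> C) N E (nu : N -> E) (g : {linear N -> M})
    (F : {linear E -> C}) : localizes theta -> localizes nu ->
  (forall x, F (nu x) = theta (g x)) ->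
  exists mu : kermod g -> kermod F, localizes mu.
Proof.
move=> [tL tk tf] [nL nk nf] hF.
have /choice[k hk] : forall x : kermod g, exists y : kermod F, ker_inj F y = nu (ker_inj g x).
  move=> x; have [|y hy] := @submod_ex _ _ _ (ker_submodule F) (nu (ker_inj g x)).
    by rewrite /kerset /= hF ker_injE (submodP x) semilinear0.
  by exists y; rewrite ker_injE.
exists k; split=> [a x y|x kx|c].
- by apply: ker_inj_inj; rewrite hk !linearP !hk nL.
- have [|s Ds hs] := nk (ker_inj g x); first by rewrite -hk kx linear0.
  by exists s => //; apply: ker_inj_inj; rewrite linearZ_LR hs linear0.
- have [s [x [Ds e]]] := nf (ker_inj F c).
  have [|u Du hu] := tk (g x).
    by rewrite -hF -e linearZ_LR ker_injE (submodP c) scaler0.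
  have [|y hy] := @submod_ex _ _ _ (ker_submodule g) (u *: x).
    by rewrite /kerset /= linearZ_LR hu.
  exists (u * s), y; split; first exact: DM.
  have {}hy : ker_inj g y = u *: x by rewrite ker_injE.
  by apply: ker_inj_inj; rewrite linearZ_LR hk hy semilinearZ // -e rmorphM scalerA.
Qed.

(** * Hom and projective dimension under localization *)

Hypothesis noeth : noetherian_module A^o.

(** [M] is finitely presented. A common denominator of the images of the generators gives a map on
    the free module; it sends the finitely generated relations to torsion, which a second
    denominator kills. *)
Lemma localizes_hom M C (theta : M -> C) N E (nu : N -> E) (f : {linear C -> E}) :
  localizes theta -> localizes nu -> fin_gen M ->
  exists s (k : {linear M -> N}), D s /\ forall x, nu (k x) = iota s *: f (theta x).
Proof.
move=> ht hn Mf; have [tL _ _] := ht; have [nL _ nf] := hn.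
have [b [g [gs Kf]]] := fin_gen_cover noeth Mf.
have [||s Ds hs] := @common_denom b
    (fun i s => exists w, iota s *: f (theta (g (delta_mx 0 i))) = nu w).
- by move=> i s t _ [w e]; exists (t *: w); rewrite rmorphM -scalerA e semilinearZ.
- by move=> i; have [s [w [Ds e]]] := nf (f (theta (g (delta_mx 0 i)))); exists s => //; exists w.
have /choice[w hw] := hs.
have e0 v : nu (rowL w v) = iota s *: f (theta (g v)).
  rewrite rowLE (semilinear_sum _ _ nL) (linear_row g) (semilinear_sum _ _ tL).
  rewrite linear_sum scaler_sumr.
  by apply: eq_bigr => i _; rewrite -hw linearZ_LR (denom_scaleA _ _ Ds).
have [|u Du hu] := @semilinear_kills _ _ _ nu (compL (rowL w) (ker_inj g)) hn Kf.
  by move=> x; rewrite !linE ker_injE e0 (submodP x) (semilinear0 tL) linear0 scaler0.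
have [|k hk] := @descend _ _ _ _ g (compL (scaleL (Dc Du) N) (rowL w)) gs.
  move=> x /(@ker_exact_at _ _ _ g)[y <-]; rewrite !linE.
  by have := hu y; rewrite !linE.
exists (u * s), k; split; first exact: DM.
by move=> x; have [v <-] := gs x; rewrite hk !linE semilinearZ // e0 rmorphM scalerA.
Qed.

Lemma aprojective_factor (R : pzRingType) (a : R) (P Q : lmodType R) (g : {linear P -> Q})
  (k : {linear Q -> P}) : projective P -> (forall x, g (k x) = a *: x) -> aprojective a Q.
Proof.
move=> Pp gk X Y q h qs; have [l hl] := Pp _ _ q (compL h g) qs.
by exists (compL l k) => x; rewrite linE hl linE gk linearZ_LR.
Qed.

(** For n = 0, multiplication by [a] on [M] factors through a free module; this localizes, and [a]
    becomes invertible. Since localization is exact, syzygies localize to syzygies. *)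
Lemma localizes_kills_above M C (theta : M -> C) a n : D a -> localizes theta -> fin_gen M ->
  kills_above a n M -> kills_above 1 n C.
Proof.
move=> Da; elim: n => [|n IH] in M C theta *; move=> ht Mf Ma.
all: have [b [g [gs Kf]]] := fin_gen_cover noeth Mf.
all: have hr := row_map_localizes b.
all: have [F hF] := localizes_map g hr ht.
  have [k hk] := Ma _ _ g (idL M) gs; have [K hK] := localizes_map k ht hr.
  apply: (@denom_kills_above1 a) => //; apply: (@aprojective_factor _ _ _ _ F K (@row_projective B b)) => c.
  have ac := Dci Da.
  have := @localizes_eq _ _ _ _ (compL F K) (scaleL ac C) ht _ c.
  rewrite !linE; apply=> x; rewrite !linE hK hF hk linE semilinearZ //; by case: ht.
have Fs := localizes_surj ht hF gs.
have [kk hkk] := localizes_ker ht hr hF.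
apply: kills_aboveS (@central1 B) (@row_projective B b) (ker_short_exact Fs) _.
apply: IH hkk Kf _.
exact: Ma (@row_projective A b) (ker_short_exact gs).
Qed.

(** For n = 0, a splitting of the localized presentation comes, up to a denominator [s], from a map
    [k]. The difference g k - s dies in the localization, so some [u] kills it, and u s factors
    through a free module. *)
Lemma localizes_kills_above_inv M C (theta : M -> C) n : localizes theta -> fin_gen M ->
  kills_above 1 n C -> exists2 a, D a & kills_above a n M.
Proof.
elim: n => [|n IH] in M C theta *; move=> ht Mf Cn.
all: have [b [g [gs Kf]]] := fin_gen_cover noeth Mf.
all: have hr := row_map_localizes b.
all: have [F hF] := localizes_map g hr ht.
all: have Fs := localizes_surj ht hF gs.
  have [h hh] := Cn _ _ F (idL C) Fs.
  have {}hh c : F (h c) = c by rewrite hh scale1r linE.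
  have [s [k [Ds hk]]] := localizes_hom h ht hr Mf.
  have [tL _ _] := ht.
  have [|u Du hu] := @semilinear_kills _ _ _ theta (subL (compL g k) (scaleL (Dc Ds) M)) ht Mf.
    move=> x; rewrite !linE semilinearB // -hF hk linearZ_LR hh semilinearZ //.
    exact: subrr.
  exists (u * s); first exact: DM.
  apply: (@aprojective_factor _ _ _ _ g (compL (scaleL (Dc Du) _) k) (@row_projective A b)).
  move=> x; have /eqP := hu x; rewrite !linE scalerBr subr_eq0 => /eqP e.
  by rewrite linearZ_LR e scalerA.
have [kk hkk] := localizes_ker ht hr hF.
have [a Da ha] := IH _ _ _ hkk Kf (Cn _ _ (@row_projective B b) (ker_short_exact Fs)).
exists a => //.
exact: kills_aboveS (Dc Da) (@row_projective A b) (ker_short_exact gs) ha.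
Qed.

(** With [M] presented as a quotient of a free module, the localization is the quotient of
    ['rV[B]_b] by [S], the relations with denominators allowed. *)
Lemma localization_ex M : fin_gen M ->
  exists (C : lmodType B) (theta : M -> C), localizes theta.
Proof.
move=> /fin_gen_row[b [g gs]]; have [rL rk rf] := row_map_localizes b.
pose S : set 'rV[B]_b := [set v | exists s w, [/\ D s, g w = 0 & iota s *: v = row_map w]].
have hS : is_submodule S.
  split=> [|v v' [s [w [Ds w0 e]]] [s' [w' [Ds' w0' e']]]|c v [s [w [Ds w0 e]]]].
  - by exists 1, 0; rewrite scaler0 linear0 semilinear0.
  - exists (s * s'), (s' *: w + s *: w'); split; first exact: DM.
      by rewrite linearD !linearZ_LR w0 w0' !scaler0 addr0.
    rewrite semilinearD // !semilinearZ // -e -e' scalerDr rmorphM -!scalerA.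
    by rewrite (denom_scaleA _ v Ds).
  - have [s0 [a [Ds0 e0]]] := frac_ex AB c.
    exists (s * s0), (a *: w); split; first exact: DM.
      by rewrite linearZ_LR w0 scaler0.
    by rewrite semilinearZ // -e -e0 rmorphM -!scalerA -!(denom_scaleA _ _ Ds).
have /choice[w hw] := gs.
have sub1 v : g v = 0 -> S (row_map v).
  by move=> gv; exists 1, v; rewrite rmorph1 scale1r.
exists (quot hS), (fun x => quot_proj hS (row_map (w x))); split=> [a x y|x|c].
- rewrite -linearP; apply/eqP; rewrite -subr_eq0 -linearB; apply/eqP/quot_proj_eq0.
  rewrite -rL -semilinearB //; apply: sub1.
  by rewrite linearB linearP !hw subrr.
- move=> /quot_proj_eq0[s [v [Ds gv e]]].
  have [|u Du hu] := rk (s *: w x - v); first by rewrite semilinearB // semilinearZ // e subrr.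
  exists (u * s); first exact: DM.
  have := congr1 g hu; rewrite linear0 linearZ_LR linearB linearZ_LR hw gv.
  by rewrite subr0 scalerA.
- have [v <-] := quot_proj_surj c; have [s [x [Ds e]]] := rf v.
  exists s, (g x); split=> //; rewrite -linearZ_LR e.
  apply/eqP; rewrite -subr_eq0 -linearB; apply/eqP/quot_proj_eq0.
  by rewrite -semilinearB //; apply: sub1; rewrite linearB hw subrr.
Qed.

Lemma preimage_submodule (I : set B^o) : is_submodule I ->
  is_submodule ([set a | I (iota a)] : set A^o).
Proof.
case=> I0 ID IZ; split=> [|a b ha hb|c a ha] /=; first by rewrite rmorph0.
  by rewrite rmorphD; exact: ID.
by rewrite rmorphM; exact: IZ.
Qed.

(** Every element of [B] is a fraction, so a left ideal of [B] is determined by its preimage, and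
    cyclic [B]-modules are localizations of cyclic [A]-modules. This supplies the input of
    [auslander]. *)
Lemma quot_preimage_localizes (I : set B^o) (hI : is_submodule I) :
  exists theta : quot (preimage_submodule hI) -> quot hI, localizes theta.
Proof.
set hJ := preimage_submodule hI.
have /choice[r hr] := @quot_proj_surj _ _ _ hJ.
have piE (a b : A) : quot_proj hJ a = quot_proj hJ b -> quot_proj hI (iota a) = quot_proj hI (iota b).
  move=> /eqP; rewrite -subr_eq0 -linearB => /eqP /quot_proj_eq0 h.
  by apply/eqP; rewrite -subr_eq0 -linearB; apply/eqP/quot_proj_eq0; rewrite -rmorphB.
exists (fun u => quot_proj hI (iota (r u))); split=> [a x y|x|c].
- rewrite -linearP; transitivity (quot_proj hI (iota (a * r x + r y))).
    by apply: piE; rewrite hr -[a * r x + r y]/(a *: r x + r y) linearP !hr.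
  by congr (quot_proj hI _); rewrite rmorphD rmorphM.
- move=> /quot_proj_eq0 h; exists 1 => //; rewrite scale1r -(hr x).
  exact/quot_proj_eq0.
- have [y <-] := quot_proj_surj c; have [s [x [Ds e]]] := frac_ex AB y.
  exists s, (quot_proj hJ x); split=> //; rewrite -linearZ_LR.
  transitivity (quot_proj hI (iota x)); first by congr (quot_proj hI _).
  by apply: piE; rewrite hr.
Qed.

Lemma quot_fin_gen (I : set A^o) (hI : is_submodule I) : fin_gen (quot hI).
Proof.
exists 1%N, (fun=> quot_proj hI 1); split=> // x _; have [a <-] := quot_proj_surj x.
exists (fun=> a); rewrite big_ord1 -linearZ_LR; congr (quot_proj hI _).
by rewrite -[RHS]/(a * 1) mulr1.
Qed.

Lemma kills_above_fractions a n : D a -> (forall M, fin_gen M -> kills_above a n M) ->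
  forall C, kills_above 1 n C.
Proof.
move=> Da hA; apply: auslander => I hI.
have [theta ht] := quot_preimage_localizes hI.
have Mf := quot_fin_gen (preimage_submodule hI).
exact: localizes_kills_above Da ht Mf (hA _ Mf).
Qed.

Lemma kills_above_of_fractions n M : fin_gen M -> (forall C, kills_above 1 n C) ->
  exists2 a, D a & kills_above a n M.
Proof.
move=> Mf hB; have [C [theta ht]] := localization_ex Mf.
exact: localizes_kills_above_inv ht Mf (hB C).
Qed.

End Fractions.

(** * Localization of a noether algebra *)

Section Localization.
Variables (L : pzRingType) (p : Spec (center L)).

Definition loc_frac (x : L) (s : denom p) : localization p := \pi_(localization p) (x, s).

Lemma loc_fracP x s y t : loc_frac x s = loc_frac y t <->
  exists u : denom p, val (val u * val t) * x = val (val u * val s) * y.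
Proof.
split=> [/eqmodP/asboolP[u hu]|[u hu]]; first by exists u.
by apply/eqmodP/asboolP; exists u.
Qed.

Lemma loc_fracM x s y t : loc_frac x s * loc_frac y t = loc_frac (x * y) (denomM s t).
Proof. by rewrite /loc_frac -[LHS]loc_piM. Qed.

Lemma loc_fracD x s y t : loc_frac x s + loc_frac y t =
  loc_frac (val (val t) * x + val (val s) * y) (denomM s t).
Proof. by rewrite /loc_frac -[LHS]loc_piD. Qed.

Lemma loc_fracW (P : localization p -> Prop) : (forall x s, P (loc_frac x s)) -> forall y, P y.
Proof. by move=> h y; rewrite -[y]reprK; case: (repr y) => x s; exact: h. Qed.

Definition loc_map (x : L^c) : (localization p)^c := loc_frac x (denom1 p).

Lemma loc_map_zmod : zmod_morphism loc_map.
Proof.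
move=> x y; apply: (@addIr _ (loc_map y)); rewrite subrK.
rewrite /loc_map [LHS]loc_fracD; apply/loc_fracP; exists (denom1 p).
by rewrite /= !mul1r subrK.
Qed.

Lemma loc_map_monoid : monoid_morphism loc_map.
Proof.
split=> // x y; rewrite /loc_map.
rewrite -[RHS]/(loc_frac y (denom1 p) * loc_frac x (denom1 p)) loc_fracM.
by apply/loc_fracP; exists (denom1 p); rewrite /= !mul1r.
Qed.

HB.instance Definition _ := GRing.isZmodMorphism.Build L^c (localization p)^c loc_map loc_map_zmod.
HB.instance Definition _ := GRing.isMonoidMorphism.Build L^c (localization p)^c loc_map loc_map_monoid.

Definition loc_denoms : set L^c :=
  [set s | exists2 c : center L, ~ spec_set p c & s = center_val c].

Lemma loc_ring_of_fractions : ring_of_fractions (loc_map : {rmorphism _ -> _}) loc_denoms.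
Proof.
split.
- by exists 1; [case: (specP p)|].
- move=> _ _ [c hc ->] [d hd ->]; exists (d * c); last by [].
  by case: (specP p) => _ _ h /h[].
- move=> _ [c hc ->] b; exact: (esym (centerC c b)).
- move=> _ [c hc ->]; elim/loc_fracW => x s.
  rewrite -[LHS]/(loc_frac x s * loc_frac c (denom1 p)).
  rewrite -[RHS]/(loc_frac c (denom1 p) * loc_frac x s) !loc_fracM.
  apply/loc_fracP; exists (denom1 p) => /=.
  by rewrite !mul1r !mulr1 -[x * _]centerC.
- move=> _ [c hc ->]; have hc' : `[< ~ spec_set p c >] by apply/asboolP.
  exists (loc_frac 1 (Denom hc')).
  rewrite -[LHS]/(loc_frac c (denom1 p) * loc_frac 1 (Denom hc')) loc_fracM.
  by apply/loc_fracP; exists (denom1 p); rewrite /= !mul1r !mulr1.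
- elim/loc_fracW => x s; exists (center_val (val s)), x; split.
    by exists (val s) => //; exact: denomP.
  rewrite -[LHS]/(loc_frac x s * loc_frac (center_val (val s)) (denom1 p)) loc_fracM.
  apply/loc_fracP; exists (denom1 p); rewrite /= !mul1r !mulr1.
  exact: (esym (centerC _ x)).
- move=> x /loc_fracP[u hu]; exists (center_val (val u)); first by exists (val u) => //; exact: denomP.
  transitivity (center_val (val u) * (x : L)); first exact: (esym (centerC (val u) x)).
  by move: hu; rewrite /= mulr1 mulr0.
Qed.

End Localization.

Lemma central_center (L : pzRingType) (c : center L) : @central L^c (center_val c).
Proof. by move=> b; exact: (esym (centerC c b)). Qed.

Lemma center_valX (L : pzRingType) (c : center L) n :
  (center_val c : L^c) ^+ n = center_val (c ^+ n).
Proof.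
elim: n => // n IH; rewrite [in RHS]exprSr exprS IH.
by [].
Qed.

Lemma ann_Ext_is_ideal (L : pzRingType) i (M N : lmodType L^c) : is_ideal (ann_Ext i.+1 M N).
Proof.
split=> [P f fc|x y hx hy P f fc|c x hx P f fc].
- by exists (zeroL _ _) => u; rewrite linE scale0r.
- have [g hg] := hx P f fc; have [h hh] := hy P f fc.
  exists (addL g h) => u; rewrite linE -hg -hh -scalerDl; congr (_ *: _).
- have [g hg] := hx P f fc.
  exists (compL (scaleL (@central_center L c) N) g) => u.
  rewrite !linE -hg scalerA; congr (_ *: _).
  exact: (centerC c x).
Qed.

(* The four inclusions *)
Local Close Scope ring_scope.

Theorem theorem4p3 (L : pzRingType) (d : nat) :
  noether_algebra L ->
  finitistic_gldim_le L d ->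
  forall (G : lmodType L^c) (s : nat),
  fin_gen G ->
  (exists n : nat, subcat_sub (syzygies_of_mod s) (generated (syzygies_of G) n)) ->
  forall H : lmodType L^c, syzygy d.+1 G H ->
  [/\ Sing L = V (ca L),
      V (ca L) = V (ca_ L (s + d + 1)),
      V (ca_ L (s + d + 1)) = V (ann_Ext d.+1 G H)
    & zariski_closed (Sing L)].
Proof.
move=> [[_ noeth] _] hd G s Gf [n hn] H GH.
have Sca : Sing L `<=` V (ca L).
  move=> p hp a [m _ ha]; apply: contrapT => ap; apply: hp; exists m.
  have aD : loc_denoms p (center_val a) by exists a.
  move=> C; apply: kills_above_pdim_le.
  apply: (kills_above_fractions (@loc_ring_of_fractions L p) noeth aD) => M Mf.
  (* Membership in ca^m is tested on finitely generated modules, so the universal class needs a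
     finitely generated (m+1)-st syzygy. *)
  have [K [Kf MK]] := fin_gen_syzygy noeth m.+1 Mf.
  apply: kills_above_of_kills_Ext MK _; first exact: central_center.
  exact: ha.
have caV : V (ca L) `<=` V (ca_ L (s + d + 1)).
  by move=> p hp a ha; apply: hp; exists (s + d + 1).
have VI : V (ca_ L (s + d + 1)) `<=` V (ann_Ext d.+1 G H).
  move=> p hp a ha; have ac := central_center a.
  have Ga := kills_above_of_kills_Ext ac GH ha.
  (* [a ^+ n] lies in ca^(s+d+1): it kills Ext^(d+1) of the s-th syzygy of any finitely generated M,
     and s dimension shifts give Ext^(s+d+1)(M, -) and above. *)
  have : spec_set p (a ^+ n)%R.
    apply: hp => M N i Mf Nf; rewrite addn1; case: i => // i; rewrite ltnS => di.
    apply: kills_Ext_kills_above; first exact: central_center.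
    apply: kills_above_leq di _; first exact: central_center.
    have [K [Kf MK]] := fin_gen_syzygy noeth s Mf.
    apply: kills_above_syzygy (MK) _; first exact: central_center.
    rewrite -center_valX; apply: (generated_kills_above ac (syzygies_of_kills_above ac Ga)).
    by apply: hn; exists M.
  case: (specP p) => _ p1 pM; elim: n {hn} => [|k IH]; first by rewrite expr0.
  by rewrite exprS => /pM[|/IH].
have VS : V (ann_Ext d.+1 G H) `<=` Sing L.
  move=> p hp hreg.
  have hk (C : lmodType (localization p)^c) : kills_above 1 d C by apply: pdim_le_kills_above; exact: hd.
  have [a [c hc ea] ha] := kills_above_of_fractions (@loc_ring_of_fractions L p) noeth Gf hk.
  apply: hc; apply: hp; rewrite {a}ea in ha.
  by apply: kills_Ext_kills_above => //; exact: central_center.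
have e1 : Sing L = V (ca L).
  by apply/seteqP; split=> // p /caV /VI /VS.
have e2 : V (ca L) = V (ca_ L (s + d + 1)).
  by apply/seteqP; split=> // p /VI /VS /Sca.
have e3 : V (ca_ L (s + d + 1)) = V (ann_Ext d.+1 G H).
  by apply/seteqP; split=> // p /VS /Sca /caV.
split=> //; exists (ann_Ext d.+1 G H); first exact: ann_Ext_is_ideal.
by rewrite e1 e2.
Qed.
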